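(* Let $1\le m\leq n$ be integers, let $K$ be an infinite field and let $S=K[x_{ij} : 1\leq i\leq m,\ 1\leq j\leq n]$ with the $\mathbb{Z}^m$-grading $\deg x_{ij}=e_i$. Let $L=(\ell_{ij})$ be a row graded $m\times n$ matrix of linear forms, i.e. $\ell_{ij}=\sum_{k=1}^n\lambda_{ijk}x_{ik}$ with $\lambda_{ijk}\in K$ (so $\ell_{ij}\in S_{e_i}$, possibly zero), and let $I_m(L)$ be the ideal of $S$ generated by the maximal minors of $L$. For $A\subseteq [m]=\{1,\dots,m\}$ let $b_L(A)$ be the dimension of the $K$-vector subspace of $\bigoplus_{i\in A}S_{e_i}$ generated by the columns of the submatrix $L_A=(\ell_{ij})_{i\in A,\, j\in [n]}$. Then: (1) $I_m(L)$ is a Cartwright-Sturmfels ideal. (2) The multigraded generic initial ideal of $I_m(L)$ is $$\operatorname{gin}(I_m(L))=\Big(x_{1a_1}\cdots x_{ma_m} : \sum_{i\in A} a_i\leq b_L(A)\ \text{ for every } A\subseteq [m]\Big),$$ where the indices $a_i$ are integers with $1\le a_i\le n$. (3) Furthermore $$\operatorname{gin}(I_m(L))=\bigcap_{a\in C}P_a,$$ where $C$ is the set of the elements $a=(a_1,\dots,a_m)\in\mathbb{N}^m$ such that for some $A\subseteq [m]$ one has $a_i=0$ for all $i\in [m]\setminus A$ and $\sum_{i\in A}a_i=b_L(A)-|A|+1$.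
   Context: $\mathbb{N}$ includes $0$; $e_1,\dots,e_m$ is the canonical basis of $\mathbb{Z}^m$, and $S_{e_i}$ is the space of homogeneous elements of degree $e_i$. For $a\in\mathbb{N}^m$, $P_a=(x_{ij} : 1\leq i\leq m,\ 1\leq j\leq a_i)$. Group actions: $G=\mathrm{GL}_n(K)^m$ acts on $S$ by $\mathbb{Z}^m$-graded $K$-algebra automorphisms, the $i$-th factor acting linearly on $\langle x_{i1},\dots,x_{in}\rangle$. The Borel subgroup $B\subset G$ consists of the $m$-tuples of invertible upper triangular matrices, i.e. of the elements $g$ such that $g(x_{ij})\in\langle x_{i1},\dots,x_{ij}\rangle$ for all $i,j$. An ideal $J$ is Borel fixed if $g(J)=J$ for all $g\in B$. Generic initial ideals: term orders $\tau$ on $S$ are always assumed to satisfy $x_{ij}>x_{ik}$ for $j<k$. For a $\mathbb{Z}^m$-graded ideal $I$, the multigraded generic initial ideal is $\operatorname{gin}_\tau(I)=\operatorname{in}_\tau(g(I))$ for a general $g\in G$ (i.e. $g$ in a suitable nonempty Zariski open subset of $G$). A $\mathbb{Z}^m$-graded ideal $I$ of $S$ is Cartwright-Sturmfels if there exists a radical Borel fixed ideal $J$ of $S$ with the same $\mathbb{Z}^m$-graded Hilbert series as $I$. It is known that for such an ideal $\operatorname{gin}_\tau(I)$ does not depend on $\tau$; it is denoted $\operatorname{gin}(I)$. *)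

(* Defs.v *)
From mathcomp Require Import all_boot all_order all_algebra.
From mathcomp Require Import mathcomp_extra boolp classical_sets functions cardinality.
From mathcomp Require Import mpoly.

Set Implicit Arguments.
Unset Strict Implicit.
Unset Printing Implicit Defensive.

Import Order.TTheory GRing.Theory Num.Theory.
Local Open Scope classical_set_scope.
Local Open Scope ring_scope.

Section Ideals.
Context {R : comNzRingType}.

Definition is_ideal (I : set R) : Prop :=
  [/\ I 0, forall f g, I f -> I g -> I (f + g) & forall a f, I f -> I (a * f)].

Definition ideal_gen (G : set R) : set R := smallest is_ideal G.

Definition is_radical (I : set R) : Prop := forall f k, I (f ^+ k) -> I f.

End Ideals.

Section Dimension.
Context {K : fieldType} {V : lmodType K}.

Definition lin_span d (b : 'I_d -> V) : set V :=
  [set \sum_i c i *: b i | c in [set: 'I_d -> K]].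

Definition lin_indep d (b : 'I_d -> V) : Prop :=
  forall c : 'I_d -> K, \sum_i c i *: b i = 0 -> forall i, c i = 0.

Definition has_dim (W : set V) (d : nat) : Prop :=
  exists b : 'I_d -> V, lin_indep b /\ lin_span b = W.

(* Only used on finite-dimensional subspaces; [subdim W] is 0 by convention when
   [W] has no finite basis. *)
Definition subdim (W : set V) : nat := xget 0%N (has_dim W).

End Dimension.

(* All 0-based indices [i : 'I_m], [j : 'I_n] stand for the 1-based indices
   i + 1 and j + 1. *)
Section Multigraded.
Variables (K : fieldType) (m n : nat).

Local Notation S := {mpoly K[m * n]}.

Definition xvar (i : 'I_m) (j : 'I_n) : S := 'X_(mxvec_index i j).

Definition mono_deg (t : 'X_{1..(m * n)}) : 'rV[int]_m :=
  \row_i (\sum_(j < n) t (mxvec_index i j))%N%:Z.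

Definition graded_piece (a : 'rV[int]_m) : set S :=
  [set f | forall t, t \in msupp f -> mono_deg t = a].

Definition component (a : 'rV[int]_m) (f : S) : S :=
  \sum_(t <- msupp f | mono_deg t == a) f@_t *: 'X_[t].

Definition is_graded (I : set S) : Prop :=
  forall f, I f -> forall a, I (component a f).

(* The coefficients of the Hilbert series of [I]. *)
Definition hilbert (I : set S) (a : 'rV[int]_m) : nat :=
  subdim (I `&` graded_piece a).

Definition GLm : set ('I_m -> 'M[K]_n) := [set g | forall i, g i \in unitmx].

Definition borel : set ('I_m -> 'M[K]_n) :=
  [set g | GLm g /\ forall i (k j : 'I_n), (j < k)%N -> g i k j = 0].

(* The algebra endomorphism xvar i j |-> \sum_k g i k j *: xvar i k. *)
Definition act (g : 'I_m -> 'M[K]_n) (f : S) : S :=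
  f \mPo [tuple mxvec (\matrix_(i, j) \sum_k g i k j *: xvar i k) 0 t | t < m * n].

Definition borel_fixed (J : set S) : Prop :=
  forall g, borel g -> act g @` J = J.

Definition cartwright_sturmfels (I : set S) : Prop :=
  [/\ is_ideal I, is_graded I &
      exists J : set S, [/\ is_ideal J, is_radical J, borel_fixed J, is_graded J
        & forall a, hilbert J a = hilbert I a]].

Definition GL_coords (g : 'I_m -> 'M[K]_n) : 'I_(m * (n * n)) -> K :=
  mxvec (\matrix_(i < m) mxvec (g i)) 0.

Definition zariski_open (U : set ('I_m -> 'M[K]_n)) : Prop :=
  exists F : set {mpoly K[m * (n * n)]},
    U = [set g | GLm g /\ exists2 p, F p & p.@[GL_coords g] != 0].

(* [tau t u] means t <= u. *)
Definition term_order (tau : rel 'X_{1..(m * n)}) : Prop :=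
  [/\ [/\ total tau, antisymmetric tau & transitive tau],
      forall t, tau 0%MM t,
      forall t u v, tau t u -> tau (t + v)%MM (u + v)%MM &
      forall i (j k : 'I_n), (j < k)%N ->
        tau U_(mxvec_index i k)%MM U_(mxvec_index i j)%MM].

Definition is_lead_mon (tau : rel 'X_{1..(m * n)}) (f : S) (t : 'X_{1..(m * n)}) :=
  t \in msupp f /\ forall u, u \in msupp f -> tau u t.

Definition initial_ideal (tau : rel 'X_{1..(m * n)}) (I : set S) : set S :=
  ideal_gen [set p | exists f t, [/\ I f, is_lead_mon tau f t & p = 'X_[t]]].

Definition is_gin_for (tau : rel 'X_{1..(m * n)}) (I J : set S) : Prop :=
  exists U, [/\ zariski_open U, U !=set0 &
    forall g, U g -> initial_ideal tau (act g @` I) = J].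

(* "gin(I) = J": the generic initial ideal is J for every term order. *)
Definition is_gin (I J : set S) : Prop :=
  forall tau, term_order tau -> is_gin_for tau I J.

Definition row_graded (L : 'M[S]_(m, n)) : Prop :=
  forall i j, exists lam : 'I_n -> K, L i j = \sum_k lam k *: xvar i k.

Definition max_minors_ideal (L : 'M[S]_(m, n)) : set S :=
  ideal_gen [set \det (colsub f L) |
             f in [set f : 'I_m -> 'I_n | {homo f : i j / (i < j)%N}]].

Definition subcolumn (L : 'M[S]_(m, n)) (A : {set 'I_m}) (j : 'I_n) :
  {ffun {i : 'I_m | i \in A} -> S} := [ffun i => L (val i) j].

Definition bL (L : 'M[S]_(m, n)) (A : {set 'I_m}) : nat :=
  subdim (lin_span (subcolumn L A)).

(* The condition 1 <= j + 1 <= a i on the 1-based index reads j < a i. *)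
Definition Pideal (a : 'I_m -> nat) : set S :=
  ideal_gen [set p | exists i (j : 'I_n), (j < a i)%N /\ p = xvar i j].

Definition gin_generators (b : {set 'I_m} -> nat) : set S :=
  [set \prod_i xvar i (a i) | a in
    [set a : 'I_m -> 'I_n |
      forall A : {set 'I_m}, (\sum_(i in A) (a i).+1 <= b A)%N]].

(* The last equation is in [int] as its right-hand side may be negative. *)
Definition Cset (b : {set 'I_m} -> nat) : set ('I_m -> nat) :=
  [set a | exists A : {set 'I_m}, (forall i, i \notin A -> a i = 0%N) /\
    (\sum_(i in A) a i)%N%:Z = (b A)%:Z - #|A|%:Z + 1].

End Multigraded.

Arguments xvar K {m n} i j.
Arguments Pideal K {m} n a.
Arguments gin_generators K {m} n b.

(* Main.v *)
From HB Require Import structures.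
Require Import Defs.
From mathcomp Require Import all_boot all_order all_algebra.
From mathcomp Require Import mathcomp_extra boolp classical_sets functions cardinality.
From mathcomp Require Import fingroup perm mpoly.
From mathcomp Require Import zify.

(** Write the [i]-th row of [L] as [sum_k x_ik lambda_ik] with vectors [lambda_ik] in
    [K^n] spanning a subspace [W_i]. Then [b_L A] is the dimension of the sum of the
    [W_i] over [i] in [A], and a general element of the group turns the [i]-th row
    into [sum_j x_ij w_ij] with vectors [w_ij] of [W_i] in general position. By
    Rado's theorem ([rado], [generic_dual_family]), general position means that the
    vectors [w_ij] with [j <= a_i] are independent as soon as the inequalities
    [sum_(i in A) a_i <= b_L A] hold for all [A].

    The whole statement follows from one fact: for general [g] and for every term
    order, the leading monomials of [g(I)] are the multiples of the monomials
    [x_(1,a_1) ... x_(m,a_m)] satisfying these inequalities.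

    Such a monomial is a leading monomial ([gin_mon_is_lead]): take the combination
    of maximal minors obtained by pairing the rows with vectors dual to the
    [w_(i,a_i)]. It only involves variables [x_ij] with [j >= a_i].

    Conversely ([lead_is_gin_mon]), let [t] be a monomial which is not a multiple of
    any of them. The positions of the first variables of [t] violate an inequality;
    a minimal violation ([minimal_violation]) gives a set [A] and integers [a_i] such
    that [t] involves only variables [x_ij] with [j > a_i] for [i] in [A], and such
    that the sum of the [a_i + 1] over [A] is [b_L A + 1]. So the vectors [w_ij] with
    [j <= a_i] and the tails [v_i = sum_(j > a_i) x_ij w_ij], for [i] in [A], are
    linearly dependent, and Cramer's rule provides a relation with polynomial
    coefficients. The relation says that a certain substitution makes the rows in [A]
    dependent, hence kills the maximal minors. By minimality and general position,
    this substitution multiplies the leading monomial of each [x_ij] with [j > a_i] by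
    a factor depending only on [i], whereas it sends the other variables to something
    smaller. A multihomogeneous element of [g(I)] with leading monomial [t] would
    then have a nonzero image ([lead_mon_below]).

    The monomial ideal so found is the intersection of the primes [P_a]
    ([gin_mon_cap]), by the same minimal violations. It is therefore radical and Borel
    fixed, and it has the Hilbert series of [I] because leading monomials count
    dimensions ([has_dim_graded]). Hence [I] is Cartwright-Sturmfels. *)

Set Implicit Arguments.
Unset Strict Implicit.
Unset Printing Implicit Defensive.

Import Order.TTheory GRing.Theory Num.Theory.
Local Open Scope ring_scope.

(** * Rado's theorem for subspaces *)

Section Rado.
Variables (K : fieldType) (n : nat) (I : finType) (U : I -> 'M[K]_n).

Implicit Types (Z : 'M[K]_n) (T R : {set I}).

Definition joinU Z T : 'M[K]_n := (Z + \sum_(r in T) U r)%MS.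

Lemma joinU_sub Z T (X : 'M[K]_n) :
  (Z <= X)%MS -> (forall r, r \in T -> (U r <= X)%MS) -> (joinU Z T <= X)%MS.
Proof.
by move=> ZX UX; rewrite /joinU addsmx_sub ZX; apply/sumsmx_subP.
Qed.

Lemma joinUl Z T : (Z <= joinU Z T)%MS.
Proof. exact: addsmxSl. Qed.

Lemma joinUr Z T r : r \in T -> (U r <= joinU Z T)%MS.
Proof. by move=> rT; apply: submx_trans (addsmxSr _ _); apply: (sumsmx_sup r). Qed.

(** By submodularity of the rank: the two tight values bound the rank of the sum
    plus the rank of the intersection, while the hypothesis bounds each of these
    from below. *)
Lemma tight_setU Z R T1 T2 :
  (forall T, T \subset R -> \rank Z + #|T| <= \rank (joinU Z T))%N ->
  T1 \subset R -> T2 \subset R ->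
  \rank (joinU Z T1) = (\rank Z + #|T1|)%N ->
  \rank (joinU Z T2) = (\rank Z + #|T2|)%N ->
  \rank (joinU Z (T1 :|: T2)) = (\rank Z + #|T1 :|: T2|)%N.
Proof.
move=> rado T1R T2R tight1 tight2.
have T12R : T1 :|: T2 \subset R by rewrite finset.subUset T1R.
have I12R : T1 :&: T2 \subset R by rewrite finset.subIset ?T1R.
have subU : (joinU Z (T1 :|: T2) <= joinU Z T1 + joinU Z T2)%MS.
  apply: joinU_sub => [|r]; first exact: submx_trans (joinUl _ _) (addsmxSl _ _).
  case/setUP=> rT; first exact: submx_trans (joinUr _ rT) (addsmxSl _ _).
  exact: submx_trans (joinUr _ rT) (addsmxSr _ _).
have subI : (joinU Z (T1 :&: T2) <= joinU Z T1 :&: joinU Z T2)%MS.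
  apply: joinU_sub => [|r /setIP[r1 r2]]; first by rewrite sub_capmx !joinUl.
  by rewrite sub_capmx !joinUr.
have := mxrank_sum_cap (joinU Z T1) (joinU Z T2).
have := mxrankS subU; have := mxrankS subI.
have := rado _ T12R; have := rado _ I12R; have := cardsUI T1 T2.
rewrite tight1 tight2; lia.
Qed.

(** Rado's theorem on independent transversals, relative to a subspace [Z]. One
    vector [u0] of [U r0] is chosen at a time and absorbed into [Z]. The condition
    survives for [Z + u0] unless [u0] lies in [joinU Z T] for a tight [T]. Tight
    sets are closed under union, so there is a largest one, and [U r0] is not
    inside its span, since adding [r0] to it would break the condition. *)
Theorem rado Z R :
  (forall T, T \subset R -> \rank Z + #|T| <= \rank (joinU Z T))%N ->
  exists2 u : I -> 'rV[K]_n, (forall r, u r <= U r)%MS &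
    \rank (Z + \sum_(r in R) <<u r>>)%MS = (\rank Z + #|R|)%N.
Proof.
have [k] := ubnP #|R|; elim: k => // k IHk in Z R *.
have [->|[r0 r0R]] := set_0Vmem R.
  move=> _ _; exists (fun=> 0) => [r|]; first exact: sub0mx.
  by rewrite big_set0 addsmx0 cards0 addn0.
rewrite (cardsD1 r0) r0R ltnS => ltRk rado.
pose R' := R :\ r0.
have R'R : R' \subset R by apply: finset.subsetDl.
pose tight T := (T \subset R') && (\rank (joinU Z T) == \rank Z + #|T|)%N.
have tight0 : tight finset.set0.
  by rewrite /tight finset.sub0set /joinU big_set0 addsmx0 cards0 addn0 eqxx.
have [Tm /andP[TmR' /eqP tightm] maxm] :=
  @arg_maxnP _ finset.set0 tight (fun T => #|T|) tight0.
have sub_max T : tight T -> T \subset Tm.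
  case/andP=> TR' /eqP tT; have: tight (Tm :|: T).
    rewrite /tight finset.subUset TmR' TR' /=; apply/eqP.
    apply: (@tight_setU _ R) => //; exact: fintype.subset_trans R'R.
  move/maxm => le_card; have/eqP : Tm = Tm :|: T.
    by apply/eqP; rewrite eqEcard finset.subsetUl.
  by move=> /eqP ->; apply: finset.subsetUr.
have notsub : ~~ (U r0 <= joinU Z Tm)%MS.
  apply/negP => Usub.
  have TR : r0 |: Tm \subset R by rewrite finset.subUset finset.sub1set r0R
    (fintype.subset_trans TmR').
  have r0Tm : r0 \notin Tm.
    by apply: contraTN isT => /(fintype.subsetP TmR'); rewrite !inE eqxx.
  have := rado _ TR; rewrite cardsU1 r0Tm.
  have /mxrankS : (joinU Z (r0 |: Tm) <= joinU Z Tm)%MS.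
    apply: joinU_sub => [|r]; first exact: joinUl.
    by case/setU1P => [->//|rT]; apply: joinUr.
  by rewrite tightm; lia.
have [l u0notin] := row_subPn notsub.
pose u0 := row l (U r0); rewrite -/u0 in u0notin.
pose Z' := (Z + u0)%MS.
have rankD (X : 'M[K]_n) : ~~ (u0 <= X)%MS -> (\rank X < \rank (X + u0)%MS)%N.
  move=> u0X; rewrite ltn_neqAle mxrankS ?addsmxSl // andbT.
  apply: contra u0X => /eqP eqr.
  have [_] := mxrank_leqif_sup (addsmxSl X u0); rewrite eqr eqxx => /esym.
  by rewrite addsmx_sub => /andP[].
have rank_u0 : (\rank u0 <= 1)%N by apply: rank_leq_row.
have u0Z : ~~ (u0 <= Z)%MS.
  by apply: contra u0notin => /submx_trans -> //; apply: joinUl.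
have rankZ' : \rank Z' = (\rank Z).+1.
  apply/eqP; rewrite eqn_leq rankD // andbT.
  have := (mxrank_adds_leqif Z u0).1; rewrite -/Z'; lia.
have rado' T : T \subset R' -> (\rank Z' + #|T| <= \rank (joinU Z' T))%N.
  move=> TR'.
  have sub1 : (joinU Z T <= joinU Z' T)%MS.
    by apply: joinU_sub => [|r]; [apply: submx_trans (addsmxSl _ _) (joinUl _ _)
                                 |exact: joinUr].
  have sub2 : (joinU Z T + u0 <= joinU Z' T)%MS.
    by rewrite addsmx_sub sub1 (submx_trans (addsmxSr Z u0)) // joinUl.
  have := rado _ (fintype.subset_trans TR' R'R); rewrite leq_eqVlt rankZ' addSn.
  case/orP => [/eqP eqT|]; last by move/leq_trans; apply; apply: mxrankS.
  have /sub_max TTm : tight T by rewrite /tight TR' eqT eqxx.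
  rewrite eqT; apply: leq_trans (mxrankS sub2); apply: rankD.
  apply: contra u0notin => /submx_trans -> //.
  by apply: joinU_sub => [|r /(fintype.subsetP TTm)]; [exact: joinUl|exact: joinUr].
have [u uU rank_u] := IHk Z' R' ltRk rado'.
exists (fun r => if r == r0 then u0 else u r) => [r|].
  by case: eqP => [->|_]; [exact: row_sub|exact: uU].
rewrite (big_setD1 r0) //= eqxx addsmxA -/R'.
rewrite (eq_bigr (fun r => <<u r>>%MS)) => [|r]; last by rewrite !inE; case: eqP.
have -> : \rank (Z + <<u0>> + \sum_(r in R') <<u r>>)%MS
        = \rank (Z' + \sum_(r in R') <<u r>>)%MS.
  apply/eqmx_rank/eqmxP.
  exact: adds_eqmx (adds_eqmx (eqmx_refl Z) (genmxE u0)) (eqmx_refl _).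
rewrite rank_u rankZ'; lia.
Qed.

End Rado.

(** * Independent families of prescribed lengths *)

Section Families.
Variables (K : fieldType) (m n : nat).
Implicit Types (w : 'I_m -> 'I_n -> 'rV[K]_n) (a : 'I_m -> nat).

Lemma card_below N (A : {set 'I_m}) a :
  (forall i, i \in A -> a i <= N)%N ->
  #|[set p : 'I_m * 'I_N | (p.1 \in A) && (p.2 < a p.1)%N]|
    = (\sum_(i in A) a i)%N.
Proof.
move=> aN; rewrite -sum1_card.
transitivity (\sum_(i in A) \sum_(j < N | (j < a i)%N) 1)%N.
  by rewrite pair_big_dep /=; apply: eq_bigl => p; rewrite inE.
apply: eq_bigr => i /aN aiN; rewrite sum1_card -[RHS]card_ord.
rewrite -(fintype.card_image (f := widen_ord aiN)) => [|x y /(congr1 val)/= /val_inj //].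
apply: eq_card => j; apply/idP/fintype.imageP => [lt_j|[k _ ->]]; last exact: (ltn_ord k).
by exists (Ordinal (lt_j : (j < a i)%N)) => //; apply: val_inj.
Qed.

(** Linear independence of the vectors [w i j] with [j < a i], phrased through a
    dual family because the dual vectors are what later proofs multiply by. *)
Definition dual_family w a := exists q : 'I_m -> 'I_n -> 'cV[K]_n,
  forall i (j : 'I_n) k (l : 'I_n), (j < a i)%N -> (l < a k)%N ->
    w i j *m q k l = ((i == k) && (j == l))%:R%:M.

Definition below a : {set 'I_m * 'I_n} :=
  [set p : 'I_m * 'I_n | (p.1 \in [set: 'I_m]%SET) && (p.2 < a p.1)%N].

Definition family_mx w a : 'M[K]_(#|below a|, n) :=
  \matrix_r w (enum_val r).1 (enum_val r).2.

(** This makes independence an open condition: for a fixed [Q] it follows from the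
    nonvanishing of one determinant. *)
Lemma dual_family_unitmx w a (Q : 'M[K]_(n, #|below a|)) :
  family_mx w a *m Q \in unitmx -> dual_family w a.
Proof.
move=> unitQ; pose Q' := Q *m invmx (family_mx w a *m Q).
have Q'1 : family_mx w a *m Q' = 1%:M by rewrite mulmxA mulmxV.
have [E0|[p0 p0a]] := set_0Vmem (below a).
  exists (fun _ _ => 0) => i j k l ltj; have: (i, j) \in below a by rewrite !inE.
  by rewrite E0 inE.
exists (fun k l => col (enum_rank_in p0a (k, l)) Q') => i j k l ltj ltl.
have ija : (i, j) \in below a by rewrite !inE.
have kla : (k, l) \in below a by rewrite !inE.
have -> : w i j = row (enum_rank_in p0a (i, j)) (family_mx w a).
  by rewrite rowK enum_rankK_in.
rewrite colE mulmxA -row_mul Q'1 -row_mul mul1mx.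
apply/matrixP => x y; rewrite !ord1 !mxE eqxx andbT mulr1n -xpair_eqE; congr (_%:R).
by rewrite (inj_in_eq (can_in_inj (enum_rankK_in p0a))).
Qed.

(** Rado's theorem applied to the family in which each [W i] is repeated [a i]
    times. *)
Lemma exists_family (W : 'I_m -> 'M[K]_n) a :
  (forall A : {set 'I_m}, \sum_(i in A) a i <= \rank (\sum_(i in A) W i)%MS)%N ->
  exists2 w, (forall i j, w i j <= W i)%MS &
    exists Q, family_mx w a *m Q = 1%:M.
Proof.
move=> radoA.
have a_le_n i : (a i <= n)%N.
  have := radoA [set i]; rewrite big_set1 => /leq_trans -> //.
  exact: rank_leq_col.
have [T Tbelow|u uW] := @rado K n _ (fun p : 'I_m * 'I_n => W p.1) 0 (below a).
  pose A := [set p.1 | p in T]; rewrite mxrank0 add0n.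
  have TA : T \subset [set p : 'I_m * 'I_n | (p.1 \in A) && (p.2 < a p.1)%N].
    apply/fintype.subsetP => p pT; rewrite inE imset_f //=.
    by have := fintype.subsetP Tbelow _ pT; rewrite !inE.
  rewrite (leq_trans (subset_leq_card TA)) // card_below //.
  apply: (leq_trans (radoA A)); apply/mxrankS/sumsmx_subP => i /imsetP[p pT ->].
  exact: (joinUr (fun p => W p.1)).
rewrite mxrank0 add0n => rank_u.
exists (fun i j => u (i, j)) => [i j|]; first exact: (uW (i, j)).
apply/row_freeP; rewrite /row_free eqn_leq rank_leq_row /= -{1}rank_u.
apply: mxrankS; rewrite addsmx_sub sub0mx; apply/sumsmx_subP => p pa.
rewrite genmxE; have -> : u p = row (enum_rank_in pa p) (family_mx (fun i j => u (i, j)) a).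
  by rewrite rowK enum_rankK_in //; case: p {pa}.
exact: row_sub.
Qed.

End Families.

(** * Nonvanishing over an infinite field *)

Section NonVanishing.
Variable K : fieldType.

Lemma eq_digits B N (s t : 'I_N -> nat) :
  (forall i, s i < B)%N -> (forall i, t i < B)%N ->
  (\sum_i s i * B ^ i = \sum_i t i * B ^ i)%N -> s =1 t.
Proof.
elim: N => [|N IHN] in s t * => sB tB; first by move=> _ [].
have Bgt0 : (0 < B)%N by apply: leq_ltn_trans (sB ord0).
rewrite !big_ord_recl /= !expn0 !muln1.
have shift (r : 'I_N.+1 -> nat) :
    (\sum_(i < N) r (lift ord0 i) * B ^ bump 0 i
      = (\sum_(i < N) r (lift ord0 i) * B ^ i) * B)%N.
  by rewrite big_distrl /=; apply: eq_bigr => i _; rewrite /bump add1n expnSr mulnA.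
rewrite !shift => eq_st.
have eq0 : s ord0 = t ord0.
  have := congr1 (modn^~ B) eq_st.
  by rewrite ![(_ ord0 + _)%N]addnC !modnMDl !modn_small.
have eqS : (fun i => s (lift ord0 i)) =1 (fun i => t (lift ord0 i)).
  apply: IHN => [i|i|]; [exact: sB|exact: tB|].
  by move: eq_st; rewrite eq0 => /addnI/eqP; rewrite eqn_pmul2r // => /eqP.
by move=> i; case: (unliftP ord0 i) => [j ->|->]; [exact: eqS|exact: eq0].
Qed.

Lemma exists_nonroot (q : {poly K}) :
  infinite_set [set: K] -> q != 0 -> exists x, q.[x] != 0.
Proof.
move=> infK q0; have [B _ Bq] := infinite_set_fset (size q) infK.
have [allr|/allPn[x _ nrx]] := boolP (all (root q) (finmap.enum_fset B)); last by exists x.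
have := max_poly_roots q0 allr (finmap.fset_uniq B).
by rewrite ltnNge Bq.
Qed.

(** Kronecker substitution: with [B] above the degree, sending the [i]-th variable
    to the power [B ^ i] of a single one separates the monomials of [p], so that
    only the univariate case remains. *)
Lemma mpoly_nonvanishing N (p : {mpoly K[N]}) :
  infinite_set [set: K] -> p != 0 -> exists v, p.@[v] != 0.
Proof.
move=> infK p0; pose B := msize p.
pose e (t : 'X_{1..N}) := (\sum_(i < N) t i * B ^ i)%N.
pose q : {poly K} := \sum_(t <- msupp p) p@_t *: 'X^(e t).
have msupp_lt t i : t \in msupp p -> (t i < B)%N.
  move=> /msize_mdeg_lt; apply: leq_ltn_trans.
  by rewrite mdegE (bigD1 i) //= leq_addr.
have q0 : q != 0.
  have [t0 t0p] : exists t, t \in msupp p.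
    by exists (mlead p); apply: mlead_supp.
  have : q`_(e t0) != 0.
    rewrite /q coef_sum (bigD1_seq t0) ?msupp_uniq //= coefZ coefXn eqxx mulr1.
    rewrite big1_seq ?addr0 -?mcoeff_msupp // => t /andP[tt0 tp].
    rewrite coefZ coefXn; case: eqP => [eqe|]; rewrite ?mulr0 //.
    case/eqP: tt0; apply/mnmP/(@eq_digits B) => [i|i|]; [exact: msupp_lt..|by []].
  by apply: contraNneq => ->; rewrite coef0.
have [x qx] := exists_nonroot infK q0; exists (fun i => x ^+ (B ^ i)).
rewrite mevalE; move: qx; rewrite /q horner_sum; congr (_ != 0).
apply: eq_bigr => t _; rewrite hornerZ hornerXn; congr (_ * _).
rewrite /e -prodrXr; apply: eq_bigr => i _.
by rewrite -exprM mulnC.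
Qed.

End NonVanishing.

(** * General position *)

Section GenericPosition.
Variables (K : fieldType) (m n : nat) (M : 'I_m -> 'M[K]_n).

Definition rado_cond (a : 'I_m -> nat) :=
  forall A : {set 'I_m}, (\sum_(i in A) a i <= \rank (\sum_(i in A) M i)%MS)%N.

(** If the [i]-th row of a matrix of linear forms has coefficient matrix [M i],
    then [moved_rows g i l] is the coefficient vector of the [l]-th variable in the
    [i]-th row after the action of [g]. *)
Definition moved_rows (g : 'I_m -> 'M[K]_n) (i : 'I_m) (l : 'I_n) : 'rV[K]_n :=
  row l (g i *m M i).

Local Notation P := {mpoly K[m * (n * n)]}.

(** The universal matrix, whose entries are the coordinates of the group. *)
Definition coord_mx (i : 'I_m) : 'M[P]_n :=
  \matrix_(l, k) 'X_(mxvec_index i (mxvec_index l k)).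

Lemma meval_coord_mx g i : map_mx (meval (GL_coords g)) (coord_mx i) = g i.
Proof. by apply/matrixP => l k; rewrite !mxE mevalXU /GL_coords mxvecE mxE mxvecE. Qed.

Lemma map_mevalC N p q (v : 'I_N -> K) (Q : 'M[K]_(p, q)) :
  map_mx (meval v) (map_mx (@mpolyC N K) Q) = Q.
Proof. by apply/matrixP => i j; rewrite !mxE mevalC. Qed.

Definition coord_family_mx (a : 'I_m -> nat) : 'M[P]_(#|below n a|, n) :=
  \matrix_r row (enum_val r).2
    (coord_mx (enum_val r).1 *m map_mx (@mpolyC _ K) (M (enum_val r).1)).

Lemma meval_coord_family_mx g a :
  map_mx (meval (GL_coords g)) (coord_family_mx a) = family_mx (moved_rows g) a.
Proof.
apply/row_matrixP => r; rewrite !rowK -map_row rowK map_row map_mxM /=.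
by rewrite meval_coord_mx map_mevalC.
Qed.

(** The polynomial is a determinant, which is nonzero because it takes the value 1
    at the matrices that produce the family given by Rado's theorem. *)
Lemma dual_family_open a : rado_cond a ->
  exists2 p : P, p != 0 & forall g, p.@[GL_coords g] != 0 ->
    dual_family (moved_rows g) a.
Proof.
move=> ra; have [w wM [Q wQ]] := exists_family ra.
pose p := \det (coord_family_mx a *m map_mx (@mpolyC _ K) Q).
have evalp g : p.@[GL_coords g] = \det (family_mx (moved_rows g) a *m Q).
  by rewrite -det_map_mx map_mxM meval_coord_family_mx map_mevalC.
exists p => [|g]; last first.
  rewrite evalp => pg; apply: (@dual_family_unitmx _ _ _ _ _ Q).
  by rewrite unitmxE unitfE.
pose g i : 'M[K]_n := \matrix_l (w i l *m pinvmx (M i)).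
have gw : moved_rows g = w.
  by apply/funext => i; apply/funext => l; rewrite /moved_rows row_mul rowK mulmxKpV.
apply: contraTneq (oner_neq0 K) => p0; apply/negPn.
by have := evalp g; rewrite p0 meval0 gw wQ det1 => <-.
Qed.

(** A family satisfying the rank inequalities has [a i <= n], so only finitely many
    open conditions are to be met at once; their product is a nonzero polynomial,
    and multiplying it by the determinants of the factors provides an invertible
    point. *)
Theorem generic_dual_family : infinite_set [set: K]%classic ->
  exists U : set ('I_m -> 'M[K]_n), [/\ zariski_open U, (U !=set0)%classic &
    forall g, U g -> GLm g /\
      forall a, rado_cond a -> dual_family (moved_rows g) a].
Proof.
move=> infK.
pose val_fun (a : {ffun 'I_m -> 'I_n.+1}) i : nat := a i.
have /choice [p pP] : forall a : {ffun 'I_m -> 'I_n.+1}, exists p : P,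
    p != 0 /\ forall g, p.@[GL_coords g] != 0 -> rado_cond (val_fun a) ->
    dual_family (moved_rows g) (val_fun a).
  move=> a; have [ra|nra] := pselect (rado_cond (val_fun a)).
    by have [p p0 pg] := dual_family_open ra; exists p; split=> // g /pg.
  by exists 1; split; [exact: oner_neq0|].
pose p0 := \prod_a p a; pose d := \prod_i \det (coord_mx i).
have evald g : d.@[GL_coords g] = \prod_i \det (g i).
  by rewrite rmorph_prod; apply: eq_bigr => i _; rewrite -det_map_mx meval_coord_mx.
have pd0 : p0 * d != 0.
  rewrite mulf_neq0 //; first by apply/prodf_neq0 => a _; case: (pP a).
  apply: contraTneq (oner_neq0 K) => d0; apply/negPn.
  have := evald (fun=> 1%:M); rewrite d0 meval0 => ->.
  by rewrite big1 // => i _; rewrite det1.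
have [v v0] := mpoly_nonvanishing infK pd0.
pose g0 i : 'M[K]_n := \matrix_(l, k) v (mxvec_index i (mxvec_index l k)).
have g0v : GL_coords g0 =1 v.
  move=> t; case/mxvec_indexP: t => i lk; case/mxvec_indexP: lk => l k.
  by rewrite /GL_coords mxvecE mxE mxvecE mxE.
exists [set g | GLm g /\ exists2 q, q = p0 & q.@[GL_coords g] != 0]%classic; split.
- by exists [set p0]%classic.
- move: v0; rewrite -(meval_eq _ g0v) mevalM evald mulf_eq0 negb_or.
  case/andP => v0 /prodf_neq0 dg0; exists g0; split; last by exists p0.
  by move=> i; rewrite unitmxE unitfE dg0.
- move=> g [Gg [_ -> p0g]]; split=> // a ra.
  have a_le i : (a i < n.+1)%N.
    rewrite ltnS; have := ra [set i]%SET; rewrite big_set1 => /leq_trans -> //.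
    by rewrite (leq_trans (rank_leq_col _)).
  pose a' := [ffun i => Ordinal (a_le i)].
  have a'E : val_fun a' = a by apply/funext => i; rewrite /val_fun ffunE.
  rewrite -a'E; apply: (pP a').2; last by rewrite a'E.
  by move: p0g; rewrite rmorph_prod => /prodf_neq0 -> .
Qed.

End GenericPosition.

(** * Minimal violations of the rank inequalities *)

Section Violation.
Variables (I : finType) (b : {set I} -> nat).

Lemma bounded_sum (A : {set I}) (s : I -> nat) N :
  (N <= \sum_(i in A) s i)%N ->
  exists a : I -> nat, [/\ forall i, (a i <= s i)%N,
    forall i, i \notin A -> a i = 0%N & (\sum_(i in A) a i = N)%N].
Proof.
elim: N => [_|N IHN ltN]; first by exists (fun=> 0%N); split=> //; rewrite big1.
have [a [le_as a0 suma]] := IHN (ltnW ltN).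
have [i iA lt_as] : exists2 i, i \in A & (a i < s i)%N.
  apply/exists_inP; rewrite -[X in is_true X]negbK negb_exists_in.
  apply: contraL ltN => /forall_inP le_sa; rewrite -leqNgt -suma.
  by apply: leq_sum => i /le_sa; rewrite -leqNgt.
exists (fun j => a j + (j == i))%N; split=> [j|j jA|].
- by case: eqP => [->|]; rewrite ?addn1 // addn0.
- by rewrite a0 //; case: eqP jA => // ->; rewrite iA.
- rewrite big_split /= suma (bigD1 i) //= eqxx big1 ?addn1 // => j /andP[_].
  by case: eqP.
Qed.

(** The vector [a + sum of e_i over A minus k], extended by zero outside [A]. *)
Definition bumped (A : {set I}) (a : I -> nat) k i :=
  if i \in A then (a i + (i != k))%N else 0%N.

(** The set [A] is a violating set of smallest size, and [a] lowers [s] until the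
    inequality at [A] fails by exactly 1. Every proper subset of [A] satisfies its
    inequality for [s], hence also for the smaller bumped vectors; on [A] itself a
    bumped vector omits one unit, which restores the inequality. The numbers
    [bumped A a k i] are thus the lengths of an independent family of full rank, and
    this is what makes the leading coefficients in the collapsing substitution nonzero. *)
Lemma minimal_violation (s : I -> nat) (A0 : {set I}) :
  (forall A B : {set I}, A \subset B -> b A <= b B)%N ->
  (b A0 < \sum_(i in A0) (s i).+1)%N ->
  exists (A : {set I}) (a : I -> nat),
  [/\ forall i, (a i <= s i)%N, forall i, i \notin A -> a i = 0%N,
      (\sum_(i in A) (a i).+1 = (b A).+1)%N &
      forall k, k \in A -> forall B : {set I}, (\sum_(i in B) bumped A a k i <= b B)%N].
Proof.
move=> mono_b viol0.
pose viol (A : {set I}) := (b A < \sum_(i in A) (s i).+1)%N.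
have [A violA minA] := @arg_minnP _ A0 viol (fun A => #|A|) viol0.
have notviol (B : {set I}) : (#|B| < #|A|)%N -> (\sum_(i in B) (s i).+1 <= b B)%N.
  by move=> ltBA; rewrite leqNgt; apply/negP => /minA; rewrite leqNgt ltBA.
have sumS (B : {set I}) (c : I -> nat) :
    (\sum_(i in B) (c i).+1 = \sum_(i in B) c i + #|B|)%N.
  by rewrite -sum1_card -big_split /=; apply: eq_bigr => i _; rewrite addn1.
have cardA : (#|A| <= (b A).+1)%N.
  have [->|[k kA]] := set_0Vmem A; first by rewrite cards0.
  rewrite (cardsD1 k) kA ltnS.
  have : (#|A :\ k| < #|A|)%N by rewrite [X in (_ < X)%N](cardsD1 k) kA.
  move/notviol; rewrite sumS => /(leq_trans (leq_addl _ _))/leq_trans -> //.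
  by apply: mono_b; apply: finset.subsetDl.
have [|a [le_as a0 suma]] := @bounded_sum A s ((b A).+1 - #|A|).
  by rewrite leq_subLR addnC -sumS.
have sumaS : (\sum_(i in A) (a i).+1 = (b A).+1)%N by rewrite sumS suma subnK.
exists A, a; split=> // k kA B.
have -> : (\sum_(i in B) bumped A a k i =
           \sum_(i in B :&: A) (a i + (i != k)))%N.
  rewrite (bigID (mem A)) /= [X in (_ + X)%N]big1 ?addn0 => [|i /andP[_]]; last first.
    by rewrite /bumped => /negbTE->.
  rewrite (eq_bigl (fun i => i \in B :&: A)) => [|i]; last by rewrite inE.
  by apply: eq_bigr => i /setIP[_ iA]; rewrite /bumped iA.
have [AB|AB] := boolP (A \subset B).
  rewrite (finset.setIidPr AB) (leq_trans _ (mono_b _ _ AB)) // -ltnS -sumaS.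
  rewrite (bigD1 k) // [X in (_ < X)%N](bigD1 k) //= eqxx addn0 addSn ltnS leq_add2l.
  by apply: leq_sum => i /andP[_ ->]; rewrite addn1.
have ltBA : (#|B :&: A| < #|A|)%N.
  apply: proper_card; rewrite finset.properEneq finset.subsetIr andbT.
  by apply: contraNneq AB => <-; apply: finset.subsetIl.
apply: leq_trans (mono_b _ _ (finset.subsetIl B A)).
apply: leq_trans (notviol _ ltBA); apply: leq_sum => i _.
by rewrite -addn1 leq_add ?le_as ?leq_b1.
Qed.

End Violation.

(** * Coefficients at a bounding monomial *)

Section Dominance.
Variables (K : idomainType) (N : nat) (le : rel 'X_{1..N}).

Definition monomial_order :=
  [/\ total le, antisymmetric le, transitive le &
      forall t u v, le t u -> le (t + v)%MM (u + v)%MM].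

Hypothesis le_order : monomial_order.

Let le_total : total le. Proof. by case: le_order. Qed.
Let le_anti : antisymmetric le. Proof. by case: le_order. Qed.
Let le_trans : transitive le. Proof. by case: le_order. Qed.
Let le_addr t u v : le t u -> le (t + v)%MM (u + v)%MM.
Proof. by case: le_order => _ _ _; apply. Qed.

Lemma mo_refl : reflexive le.
Proof. by move=> t; have := le_total t t; rewrite orbb. Qed.

Lemma mo_addD t u t' u' : le t t' -> le u u' -> le (t + u)%MM (t' + u')%MM.
Proof.
move=> tt' uu'; apply: le_trans (le_addr u tt') _.
by rewrite ![(t' + _)%MM]addmC; apply: le_addr.
Qed.

Lemma mo_addD_eq t u t' u' : le t t' -> le u u' ->
  ((t + u)%MM == (t' + u')%MM) = (t == t') && (u == u').
Proof.
move=> tt' uu'; apply/eqP/andP => [eq_tu|[/eqP-> /eqP->]//].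
have eq_t : t = t'.
  apply: (@addIm _ u); apply: le_anti; rewrite le_addr //= eq_tu.
  exact: mo_addD (mo_refl _) uu'.
by move: eq_tu; rewrite eq_t => /addmI ->; rewrite !eqxx.
Qed.

(** The coefficient [c] may vanish: then [p] only has monomials strictly below [t].
    This makes the notion stable under sums, products and determinants. *)
Definition dominated (t : 'X_{1..N}) (c : K) (p : {mpoly K[N]}) :=
  p@_t = c /\ forall u, u \in msupp p -> le u t.

Lemma dominated0 t : dominated t 0 0.
Proof. by split=> [|u]; rewrite ?mcoeff0 // msupp0. Qed.

Lemma dominatedX t : dominated t 1 'X_[t].
Proof.
split=> [|u]; first by rewrite mcoeffX eqxx.
by rewrite msuppX inE => /eqP ->; apply: mo_refl.
Qed.

Lemma dominatedZ t c a p : dominated t c p -> dominated t (a * c) (a *: p).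
Proof. by case=> <- le_p; split=> [|u /msuppZ_le /le_p]; rewrite ?mcoeffZ. Qed.

Lemma dominatedD t c d p q :
  dominated t c p -> dominated t d q -> dominated t (c + d) (p + q).
Proof.
case=> <- le_p [<- le_q]; split=> [|u]; first by rewrite mcoeffD.
by move=> /msuppD_le; rewrite mem_cat => /orP[/le_p|/le_q].
Qed.

Lemma dominated_sum I (r : seq I) (P : pred I) t (c : I -> K) (p : I -> {mpoly K[N]}) :
  (forall i, P i -> dominated t (c i) (p i)) ->
  dominated t (\sum_(i <- r | P i) c i) (\sum_(i <- r | P i) p i).
Proof.
move=> dom; apply: (big_ind2 (dominated t)) => //; first exact: dominated0.
by move=> ? ? ? ? ? ?; apply: dominatedD.
Qed.

Lemma dominated_sum0 I (r : seq I) (P : pred I) t (p : I -> {mpoly K[N]}) :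
  (forall i, P i -> dominated t 0 (p i)) -> dominated t 0 (\sum_(i <- r | P i) p i).
Proof.
move=> dom; apply: big_ind => //; first exact: dominated0.
by move=> p1 p2 dom1 dom2; rewrite -[0]addr0; apply: dominatedD.
Qed.

Lemma dominated_weaken t u c p :
  dominated t c p -> le t u -> t != u -> dominated u 0 p.
Proof.
move=> [_ le_p] le_tu ne_tu; split=> [|v /le_p le_vt]; last exact: le_trans le_tu.
apply/eqP; rewrite mcoeff_eq0; apply: contra ne_tu => /le_p le_ut.
by apply/eqP/le_anti; rewrite le_tu.
Qed.

(** In an ordered monoid, [k + l = t + u] with [k <= t] and [l <= u] forces [k = t]
    and [l = u]. *)
Lemma dominatedM t u c d p q :
  dominated t c p -> dominated u d q -> dominated (t + u)%MM (c * d) (p * q).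
Proof.
move=> [<- le_p] [<- le_q].
have pick (r : {mpoly K[N]}) v :
    r@_v = \sum_(k <- msupp r) r@_k * (k == v)%:R.
  rewrite {1}[r]mpolyE raddf_sum; apply: eq_bigr => k _.
  by rewrite /= mcoeffZ mcoeffX.
rewrite [p@_t]pick [q@_u]pick mpolyME big_allpairs big_distrl /=.
rewrite big_seq [X in dominated _ _ X]big_seq; apply: dominated_sum => k kp.
rewrite big_distrr /=.
rewrite big_seq [X in dominated _ _ X]big_seq; apply: dominated_sum => l lq.
rewrite mulrACA -natrM mulnb -mo_addD_eq ?le_p ?le_q //; apply: dominatedZ.
have le_kl : le (k + l)%MM (t + u)%MM by rewrite mo_addD ?le_p ?le_q.
have [->|ne_kl] := eqVneq; first exact: dominatedX.
exact: dominated_weaken (dominatedX _) _ _.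
Qed.

Lemma dominated_prod I (r : seq I) (P : pred I) (t : I -> 'X_{1..N}) (c : I -> K)
    (p : I -> {mpoly K[N]}) :
  (forall i, P i -> dominated (t i) (c i) (p i)) ->
  dominated (\sum_(i <- r | P i) t i)%MM (\prod_(i <- r | P i) c i)
    (\prod_(i <- r | P i) p i).
Proof.
move=> dom; elim/big_rec3: _ => [|i p' c' t' Pi dom'].
  by have := dominatedX 0%MM; rewrite mpolyX0.
exact: dominatedM (dom i Pi) dom'.
Qed.

Lemma dominatedXn t c p k :
  dominated t c p -> dominated (t *+ k)%MM (c ^+ k) (p ^+ k).
Proof.
move=> dom; elim: k => [|k IHk].
  by have := dominatedX 0%MM; rewrite mpolyX0.
by rewrite mulmS !exprS; apply: dominatedM.
Qed.

Lemma dominatedC a : dominated 0%MM a a%:MP.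
Proof.
by have := dominatedZ a (dominatedX 0%MM); rewrite mpolyX0 mulr1 -mul_mpolyC mulr1.
Qed.

Lemma dominated_det k (t : 'I_k -> 'X_{1..N}) (H0 : 'M[K]_k) (H : 'M[{mpoly K[N]}]_k) :
  (forall i j, dominated (t i) (H0 i j) (H i j)) ->
  dominated (\sum_i t i)%MM (\det H0) (\det H).
Proof.
move=> dom; apply: dominated_sum => s _.
rewrite -[X in dominated X]add0m; apply: dominatedM; last exact: dominated_prod.
by rewrite -(rmorph_sign (@mpolyC N K)); apply: dominatedC.
Qed.

End Dominance.

(** * Ideals and the multigrading *)

Section IdealBasics.
Variable R : comNzRingType.
Implicit Types (I J G : set R).

Lemma ideal_gen_ideal G : is_ideal (ideal_gen G).
Proof.
split=> [J [[]] // | f g fG gG J JG | a f fG J JG].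
  by case: (JG) => [[_ addJ _] _]; apply: addJ; [exact: fG|exact: gG].
by case: (JG) => [[_ _ mulJ] _]; apply: mulJ; exact: fG.
Qed.

Lemma sub_ideal_gen G : (G `<=` ideal_gen G)%classic.
Proof. exact: sub_smallest. Qed.

Lemma ideal_gen_min G J : is_ideal J -> (G `<=` J)%classic -> (ideal_gen G `<=` J)%classic.
Proof. by move=> idJ GJ f; apply; split. Qed.

Lemma ideal_zero I : is_ideal I -> I 0.
Proof. by case. Qed.

Lemma ideal_mul I a f : is_ideal I -> I f -> I (a * f).
Proof. by case=> _ _; apply. Qed.

Lemma ideal_sum I (T : Type) (r : seq T) (P : pred T) (F : T -> R) :
  is_ideal I -> (forall x, P x -> I (F x)) -> I (\sum_(x <- r | P x) F x).
Proof. by move=> [I0 ID _] IF; apply: big_ind. Qed.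

End IdealBasics.

Section Multigrading.
Variables (K : fieldType) (m n : nat).
Local Notation S := {mpoly K[m * n]}.
Implicit Types (t u : 'X_{1..(m * n)}) (a b : 'rV[int]_m) (f p q : S).

Lemma big_mxvec (T : Type) (idx : T) (op : Monoid.com_law idx) (F : 'I_(m * n) -> T) :
  \big[op/idx]_k F k = \big[op/idx]_(i < m) \big[op/idx]_(j < n) F (mxvec_index i j).
Proof.
rewrite pair_big (reindex _ (curry_mxvec_bij m n)) /=.
by apply: eq_bigr => -[].
Qed.

Lemma eq_mxvec_index (i i' : 'I_m) (j j' : 'I_n) :
  (mxvec_index i j == mxvec_index i' j') = (i == i') && (j == j').
Proof. by rewrite (inj_eq (@cast_ord_inj _ _ _)) (inj_eq enum_rank_inj). Qed.

Lemma mono_degD t u : mono_deg (t + u)%MM = mono_deg t + mono_deg u.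
Proof.
apply/rowP => i; rewrite !mxE -PoszD -big_split /=; congr Posz.
by apply: eq_bigr => j _; rewrite mnmDE.
Qed.

Lemma mono_degP t u :
  mono_deg t = mono_deg u <->
  forall i, (\sum_(j < n) t (mxvec_index i j) = \sum_(j < n) u (mxvec_index i j))%N.
Proof.
split=> [/rowP eq_tu i|eq_tu]; first by have := eq_tu i; rewrite !mxE => -[].
by apply/rowP => i; rewrite !mxE eq_tu.
Qed.

Lemma mcoeff_component a f t :
  (component a f)@_t = if mono_deg t == a then f@_t else 0.
Proof.
rewrite /component raddf_sum /=.
under eq_bigr do rewrite mcoeffZ mcoeffX.
have [tf|tf] := boolP (t \in msupp f); last first.
  rewrite (memN_msupp_eq0 tf) if_same big1_seq // => u /andP[_ uf].
  by case: eqP => [eq_ut|]; rewrite ?mulr0 //; move: tf; rewrite -eq_ut uf.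
case: ifP => [ta|nta].
  rewrite -big_filter (bigD1_seq t) ?mem_filter ?ta ?filter_uniq //=.
  rewrite eqxx mulr1 big1 ?addr0 // => u /negPf ut; by rewrite ut mulr0.
by apply: big1 => u ua; case: eqP => [eq_ut|_]; [rewrite -eq_ut ua in nta|rewrite mulr0].
Qed.

Lemma component_linear a c f p :
  component a (c *: f + p) = c *: component a f + component a p.
Proof.
apply/mpolyP => t; rewrite mcoeffD mcoeffZ !mcoeff_component mcoeffD mcoeffZ.
by case: ifP; rewrite ?mulr0 ?addr0.
Qed.

Lemma component0 a : component a (0 : S) = 0.
Proof. by rewrite /component msupp0 big_nil. Qed.

Lemma componentD a : {morph @component K m n a : f p / f + p}.
Proof. by move=> f p; have := component_linear a 1 f p; rewrite !scale1r. Qed.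

Lemma componentZ a c f : component a (c *: f) = c *: component a f.
Proof. by have := component_linear a c f 0; rewrite !addr0 component0 addr0. Qed.

Lemma component_sum a (T : Type) (r : seq T) (P : pred T) (F : T -> S) :
  component a (\sum_(x <- r | P x) F x) = \sum_(x <- r | P x) component a (F x).
Proof. exact: (big_morph _ (componentD a) (component0 a)). Qed.

Lemma component_graded a b f :
  graded_piece b f -> component a f = if b == a then f else 0.
Proof.
move=> fb; apply/mpolyP => t; rewrite mcoeff_component.
have [tf|tf] := boolP (t \in msupp f); first by rewrite (fb t tf); case: ifP; rewrite ?mcoeff0.
by rewrite (memN_msupp_eq0 tf) if_same; case: ifP; rewrite ?mcoeff0 ?(memN_msupp_eq0 tf).
Qed.

Lemma component_in a f : graded_piece a (component a f).
Proof.
by move=> t; rewrite mcoeff_msupp mcoeff_component; case: ifP => [/eqP //|_]; rewrite eqxx.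
Qed.

Lemma graded_piece0 a : graded_piece a (0 : S).
Proof. by move=> t; rewrite msupp0. Qed.

Lemma graded_pieceD a f p : graded_piece a f -> graded_piece a p -> graded_piece a (f + p).
Proof. by move=> fa pa t /msuppD_le; rewrite mem_cat => /orP[/fa|/pa]. Qed.

Lemma graded_pieceZ a c f : graded_piece a f -> graded_piece a (c *: f).
Proof. by move=> fa t /msuppZ_le /fa. Qed.

Lemma graded_pieceX t : graded_piece (mono_deg t) ('X_[t] : S).
Proof. by move=> u; rewrite msuppX inE => /eqP->. Qed.

Lemma graded_pieceM a b f p :
  graded_piece a f -> graded_piece b p -> graded_piece (a + b) (f * p).
Proof.
move=> fa pb t /msuppM_le /allpairsP[[u v] /= [/fa <- /pb <- ->]].
exact: mono_degD.
Qed.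

Lemma graded_piece_sum a (T : Type) (r : seq T) (P : pred T) (F : T -> S) :
  (forall x, P x -> graded_piece a (F x)) -> graded_piece a (\sum_(x <- r | P x) F x).
Proof. by move=> Fa; apply: big_ind => //; [exact: graded_piece0|exact: graded_pieceD]. Qed.

Lemma graded_piece1 : graded_piece 0 (1 : S).
Proof.
have deg0 : mono_deg (0%MM : 'X_{1..(m * n)}) = 0.
  by apply/rowP => i; rewrite !mxE big1 // => j _; rewrite mnm0E.
by have := @graded_pieceX 0%MM; rewrite mpolyX0 deg0.
Qed.

Lemma graded_piece_prod (T : Type) (r : seq T) (P : pred T) (d : T -> 'rV[int]_m) (F : T -> S) :
  (forall x, P x -> graded_piece (d x) (F x)) ->
  graded_piece (\sum_(x <- r | P x) d x) (\prod_(x <- r | P x) F x).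
Proof.
move=> Fd; elim/big_rec2: _ => [|x p a Px IH]; first exact: graded_piece1.
by apply: graded_pieceM IH; apply: Fd.
Qed.

Lemma graded_pieceXn a f k : graded_piece a f -> graded_piece (a *+ k) (f ^+ k).
Proof.
move=> fa; elim: k => [|k IHk]; first exact: graded_piece1.
by rewrite mulrS exprS; apply: graded_pieceM.
Qed.

Lemma component_XM a t f :
  component a ('X_[t] * f) = 'X_[t] * component (a - mono_deg t) f.
Proof.
rewrite [in LHS](mpolyE f) big_distrr /= component_sum.
rewrite [in RHS](mpolyE f) component_sum big_distrr /=.
apply: eq_bigr => u _; rewrite -scalerAr -mpolyXD.
rewrite (component_graded a (graded_pieceZ (@graded_pieceX _))).
rewrite (component_graded _ (graded_pieceZ (@graded_pieceX _))).
have -> : (mono_deg (t + u)%MM == a) = (mono_deg u == a - mono_deg t).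
  by rewrite mono_degD addrC [RHS]eq_sym subr_eq eq_sym.
by case: ifP; rewrite ?mulr0 // -scalerAr mpolyXD.
Qed.

(** The elements all of whose components lie in the ideal form an ideal containing
    the homogeneous generators. *)
Lemma ideal_gen_graded (G : set S) :
  (forall p, G p -> exists b, graded_piece b p) -> is_graded (ideal_gen G).
Proof.
move=> hom_G f fG; pose J := [set f : S | forall a, ideal_gen G (component a f)]%classic.
have [I0 ID IM] := ideal_gen_ideal G.
suff: J f by [].
apply: (ideal_gen_min _ _ fG).
  split=> [a|p q Jp Jq a|p q Jq a]; first by rewrite component0.
    by rewrite componentD; apply: ID; [exact: Jp|exact: Jq].
  rewrite [p]mpolyE big_distrl /= component_sum; apply: ideal_sum => // t _.
  rewrite -scalerAl componentZ component_XM -mul_mpolyC.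
  by apply: (IM); apply: (IM); exact: Jq.
move=> p Gp a; have [b pb] := hom_G p Gp.
by rewrite (component_graded a pb); case: ifP => // _; apply: sub_ideal_gen.
Qed.

End Multigrading.

(** * The collapsing substitution *)

Section Substitution.
Variables (K : fieldType) (m n : nat).
Local Notation S := {mpoly K[m * n]}.

(** Both the action of the group and the collapsing substitution have this form. *)
Definition subst_mx (F : 'M[S]_(m, n)) (f : S) : S :=
  f \mPo [tuple mxvec F 0 t | t < m * n].

HB.instance Definition _ F := GRing.LRMorphism.copy (subst_mx F)
  (comp_mpoly [tuple mxvec F 0 t | t < m * n]).

Lemma subst_xvar F i j : subst_mx F (xvar K i j) = F i j.
Proof. by rewrite /subst_mx comp_mpolyXU -tnth_nth tnth_mktuple mxvecE. Qed.

Lemma subst_mpolyX F (t : 'X_{1..(m * n)}) :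
  subst_mx F 'X_[t] = \prod_i \prod_j F i j ^+ t (mxvec_index i j).
Proof.
rewrite /subst_mx comp_mpolyX big_mxvec; apply: eq_bigr => i _; apply: eq_bigr => j _.
by rewrite tnth_mktuple mxvecE.
Qed.

Lemma subst_mpolyE F f :
  subst_mx F f = \sum_(t <- msupp f) f@_t *: subst_mx F 'X_[t].
Proof. by rewrite {1}[f]mpolyE linear_sum; apply: eq_bigr => t _; rewrite linearZ. Qed.

(** The general row graded matrix: the group only changes the family [w]. *)
Definition forms_mx (w : 'I_m -> 'I_n -> 'rV[K]_n) : 'M[S]_(m, n) :=
  \matrix_(i, c) \sum_j w i j 0 c *: xvar K i j.

Lemma subst_forms_mx F w i c :
  subst_mx F (forms_mx w i c) = \sum_j w i j 0 c *: F i j.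
Proof.
by rewrite mxE linear_sum; apply: eq_bigr => j _; rewrite linearZ /= subst_xvar.
Qed.

End Substitution.

Section Coordinates.
Variable K : fieldType.

(** Coordinates on the row space of [B], with at least one coordinate to spare,
    which is identically zero. The spare coordinate turns the linear relations
    between [s] vectors of this space into the kernel of a square matrix. *)
Lemma coordinates n (B : 'M[K]_n) s : (\rank B < s)%N ->
  exists (Q : 'M[K]_(n, s)) (P : 'M[K]_(s, n)) (l : 'I_s),
    (forall v : 'rV[K]_n, (v <= B)%MS -> v *m Q *m P = v) /\ (forall i, Q i l = 0).
Proof.
move=> lt_s; have [k ->] : exists k, s = (\rank B + k.+1)%N.
  by exists (s - (\rank B).+1)%N; lia.
exists (row_mx (pinvmx (row_base B)) 0), (col_mx (row_base B) 0), (rshift _ ord0).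
split=> [v vB|i]; last by rewrite row_mxEr mxE.
by rewrite mul_mx_row mul_row_col !mulmx0 addr0 mulmxKpV ?eq_row_base.
Qed.

End Coordinates.

Section UpperBound.
Variables (K : fieldType) (m n : nat).
Local Notation S := {mpoly K[m * n]}.
Variables (w : 'I_m -> 'I_n -> 'rV[K]_n) (M : 'I_m -> 'M[K]_n).
Hypothesis wM : forall i j, (w i j <= M i)%MS.
Variables (A : {set 'I_m}) (a : 'I_m -> nat).
Let B := (\sum_(i in A) M i)%MS.
Hypothesis sumA : (\sum_(i in A) (a i).+1 = (\rank B).+1)%N.
Hypothesis bumped_le : forall k, k \in A -> forall i, (bumped A a k i <= n)%N.
Hypothesis dualA : forall k, k \in A -> dual_family w (bumped A a k).

(** Pairs [(i, j)] with [i] in [A] and [j <= a i]. A pair with [j < a i] indexes the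
    vector [w i j], and the pair with [j = a i] indexes the tail
    [v_i = sum of x_ij' w_ij' over j' >= a i]. Indices being 0-based, [v_i] starts
    with the first variable that is kept. There is one more vector than the rank
    allows, hence a linear relation. *)
Definition rel_index : {set 'I_m * 'I_n.+1} :=
  [set p : 'I_m * 'I_n.+1 | (p.1 \in A) && (p.2 < (a p.1).+1)%N].
Local Notation s := #|rel_index|.
Local Notation ri r := (enum_val r).1.
Local Notation rj r := (nat_of_ord (enum_val r).2).

Lemma a_le i : i \in A -> (a i <= n)%N.
Proof. by move=> iA; have := bumped_le iA i; rewrite /bumped iA eqxx addn0. Qed.

Lemma card_rel_index : s = (\rank B).+1.
Proof.
by rewrite (card_below (a := fun i => (a i).+1)) // => i iA; rewrite ltnS a_le.
Qed.

Lemma ri_in (r : 'I_s) : ri r \in A.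
Proof. by have := enum_valP r; rewrite inE => /andP[]. Qed.

Lemma rj_le (r : 'I_s) : (rj r <= a (ri r))%N.
Proof. by have := enum_valP r; rewrite inE ltnS => /andP[]. Qed.

Lemma rel_index_inj (r r' : 'I_s) : ri r = ri r' -> rj r = rj r' -> r = r'.
Proof.
move=> eqi /val_inj eqj; apply: enum_val_inj.
by rewrite [enum_val r]surjective_pairing eqi eqj -surjective_pairing.
Qed.

Lemma rel_index_exists i j : i \in A -> (j <= a i)%N -> exists r : 'I_s, ri r = i /\ rj r = j.
Proof.
move=> iA ji; have jn : (j < n.+1)%N by rewrite ltnS (leq_trans ji) ?a_le.
have pR : (i, Ordinal jn) \in rel_index by rewrite inE iA ltnS.
by exists (enum_rank_in pR (i, Ordinal jn)); rewrite enum_rankK_in.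
Qed.

Variables (Q : 'M[K]_(n, s)) (P : 'M[K]_(s, n)) (l : 'I_s).
Hypothesis QP : forall v : 'rV[K]_n, (v <= B)%MS -> v *m Q *m P = v.
Hypothesis Ql : forall i, Q i l = 0.

(** The coefficient of [w i j'] in the vector indexed by [(i, j)]. *)
Definition rel_entry i j (j' : 'I_n) : S :=
  if (j < a i)%N then (nat_of_ord j' == j)%:R else if (a i <= j')%N then xvar K i j' else 0.

Definition rel_mx : 'M[S]_s :=
  \matrix_(r, c) \sum_j (w (ri r) j *m Q) 0 c *: rel_entry (ri r) (rj r) j.

(** The relation is read off a row of the adjugate: the matrix is singular, so each
    row of its adjugate is in its left kernel. *)
Definition relation_coef r := (\adj rel_mx) l r.

Lemma w_sub i j : i \in A -> (w i j <= B)%MS.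
Proof. by move=> iA; apply: submx_trans (wM i j) _; apply: (sumsmx_sup i). Qed.

Lemma relation_coefP c : \sum_r relation_coef r * rel_mx r c = 0.
Proof.
have det0 : \det rel_mx = 0.
  rewrite (expand_det_col _ l) big1 // => r _; rewrite mxE big1 ?mul0r // => j _.
  by rewrite mxE big1 ?scale0r // => i _; rewrite Ql mulr0.
have /matrixP/(_ l c) := mul_adj_mx rel_mx.
by rewrite det0 !mxE mul0rn.
Qed.

Lemma relation_rows c :
  \sum_r \sum_j w (ri r) j 0 c *: (relation_coef r * rel_entry (ri r) (rj r) j) = 0.
Proof.
transitivity (\sum_d P d c *: \sum_r relation_coef r * rel_mx r d); last first.
  by apply: big1 => d _; rewrite relation_coefP scaler0.
under [RHS]eq_bigr do rewrite scaler_sumr.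
rewrite [RHS]exchange_big; apply: eq_bigr => r _ /=.
under [RHS]eq_bigr do rewrite mxE big_distrr scaler_sumr /=.
rewrite [RHS]exchange_big; apply: eq_bigr => j _ /=.
rewrite -[in LHS](QP (w_sub j (ri_in r))) mxE scaler_suml; apply: eq_bigr => d _.
by rewrite -scalerAr scalerA mulrC.
Qed.

(** Multiplying the relation out gives [sum_i sum_j (collapse_mx i j) w_ij = 0] over
    [i] in [A]: the substitution [x_ij := collapse_mx i j] makes the rows indexed by
    [A] dependent and kills the maximal minors. *)
Definition collapse_mx : 'M[S]_(m, n) := \matrix_(i, j)
  if i \in A then \sum_(r | ri r == i) relation_coef r * rel_entry i (rj r) j else xvar K i j.

Lemma collapse_rows c : \sum_(i in A) \sum_j w i j 0 c *: collapse_mx i j = 0.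
Proof.
rewrite -[RHS](relation_rows c).
rewrite [RHS](partition_big (fun r => ri r) (mem A)) => [|r _]; last exact: ri_in.
apply: eq_bigr => i iA; rewrite exchange_big; apply: eq_bigr => j _ /=.
by rewrite mxE iA scaler_sumr; apply: eq_bigr => r /eqP ->.
Qed.

Lemma collapse_kills_minors f : max_minors_ideal (forms_mx w) f -> subst_mx collapse_mx f = 0.
Proof.
pose J := [set f : S | subst_mx collapse_mx f = 0]%classic.
move=> fI; suff: J f by [].
apply: (ideal_gen_min _ _ fI) => [|_ [h _ <-]].
  split=> [|p q Jp Jq|p q Jq]; rewrite /J /=; first exact: rmorph0.
    by rewrite rmorphD /= Jp Jq addr0.
  by rewrite rmorphM /= Jq mulr0.
rewrite /J /= -det_map_mx; apply/eqP/det0P.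
have [i0 i0A] : exists i, i \in A.
  have [E|[i iA]] := set_0Vmem A; last by exists i.
  by move: sumA; rewrite E big_set0.
exists (\row_i (i \in A)%:R).
  by apply/rV0Pn; exists i0; rewrite mxE i0A oner_neq0.
apply/rowP => k; rewrite !mxE -[RHS](collapse_rows (h k)) [RHS]big_mkcond.
apply: eq_bigr => i _; rewrite mxE; case: ifP; rewrite ?mul0r // mul1r => _.
by rewrite !mxE -(subst_forms_mx collapse_mx w) mxE.
Qed.


Variable le : rel 'X_{1..(m * n)}.
Hypothesis le_order : monomial_order le.
Hypothesis le_var : forall i (j k : 'I_n), (j < k)%N ->
  le U_(mxvec_index i k)%MM U_(mxvec_index i j)%MM.
Local Notation dominated := (dominated le).
Local Notation U i j := (U_(mxvec_index i j)%MM : 'X_{1..(m * n)}).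

Definition var_mon i (j : nat) : 'X_{1..(m * n)} :=
  (\sum_(j' : 'I_n | nat_of_ord j' == j) U i j')%MM.

Definition nat_row i (j : nat) : 'rV[K]_n :=
  \sum_(j' : 'I_n | nat_of_ord j' == j) w i j'.

Lemma var_monE i (j : 'I_n) : var_mon i j = U i j.
Proof. by rewrite /var_mon (big_pred1 j). Qed.

Lemma nat_rowE i (j : 'I_n) : nat_row i j = w i j.
Proof. by rewrite /nat_row (big_pred1 j). Qed.

Lemma nat_row_sub i j : i \in A -> (nat_row i j <= B)%MS.
Proof. by move=> iA; apply: summx_sub => j' _; apply: w_sub. Qed.

Lemma dominated_var_lt i (j k : 'I_n) c :
  (j < k)%N -> dominated (U i j) 0 (c *: xvar K i k).
Proof.
move=> lt_jk; apply: (dominated_weaken le_order (dominatedZ _ (dominatedX _ le_order _))).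
  exact: le_var.
by rewrite eq_mnm1 eq_mxvec_index eqxx /=; apply: contraTneq lt_jk => ->; rewrite ltnn.
Qed.

Definition top_mon (r : 'I_s) : 'X_{1..(m * n)} :=
  if rj r == a (ri r) then var_mon (ri r) (a (ri r)) else 0%MM.

Definition top_row (r : 'I_s) : 'rV[K]_s := nat_row (ri r) (rj r) *m Q.

Lemma rel_mx_dominated r c : dominated (top_mon r) (top_row r 0 c) (rel_mx r c).
Proof.
rewrite /top_mon /top_row /nat_row mulmx_suml summxE [rel_mx r c]mxE big_mkcond.
apply: dominated_sum => // j _; rewrite /rel_entry.
have [lt_ja|le_aj] := ltnP (rj r) (a (ri r)).
  rewrite ltn_eqF //; case: eqP => _; last by rewrite scaler0; apply: dominated0.
  by have := dominatedC le_order ((w (ri r) j *m Q) 0 c); rewrite -mul_mpolyC mulr1.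
have -> : rj r = a (ri r) by apply/eqP; rewrite eqn_leq rj_le.
rewrite eqxx; case: (ltngtP j (a (ri r))) => [lt_ja|lt_aj|eq_ja].
- by rewrite scaler0; apply: dominated0.
- by rewrite (var_monE _ (Ordinal (ltn_trans lt_aj (ltn_ord j)))); apply: dominated_var_lt.
- rewrite -eq_ja var_monE -[X in dominated _ X]mulr1.
  exact: dominatedZ (dominatedX _ le_order _).
Qed.

Lemma relation_coefE r :
  relation_coef r = \det (\matrix_(r', c) if r' == r then (c == l)%:R else rel_mx r' c).
Proof.
rewrite /relation_coef mxE (expand_det_row _ r) (bigD1 l) //= mxE !eqxx mul1r.
rewrite big1 ?addr0 => [|c /negPf cl]; last by rewrite mxE eqxx cl mul0r.
congr (_ * \det _); apply/matrixP => i j; rewrite !mxE.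
by rewrite eq_sym (negPf (neq_lift _ _)).
Qed.

Lemma relation_coef_dominated r (t : 'I_s -> 'X_{1..(m * n)}) (H : 'I_s -> 'rV[K]_s) :
  (forall r' c, r' != r -> dominated (t r') (H r' 0 c) (rel_mx r' c)) ->
  dominated (\sum_(r' | r' != r) t r')%MM
    (\det (\matrix_(r', c) if r' == r then (c == l)%:R else H r' 0 c)) (relation_coef r).
Proof.
move=> domH; rewrite relation_coefE [X in dominated X]big_mkcond.
apply: dominated_det => // r' c; rewrite mxE [X in dominated _ _ X]mxE.
case: eqP => [_|/eqP r'r]; last exact: domH.
have -> : (c == l)%:R = (c == l)%:R%:MP :> S by rewrite mpolyC_nat.
exact: dominatedC.
Qed.

Definition top_mons k : 'X_{1..(m * n)} := (\sum_(r | ri r != k) top_mon r)%MM.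

(** The leading monomial of the coefficient of [v_k] is the product of the variables
    [x_(i, a i)] over [i <> k] in [A], because [v_k] is the only row of block
    [k] that involves variables. *)
Lemma top_monsE k (P' : pred 'I_s) :
  (forall r, ri r != k -> P' r) ->
  (forall r, P' r -> ri r = k -> rj r != a k) ->
  (\sum_(r | P' r) top_mon r)%MM = top_mons k.
Proof.
move=> P1 P2; rewrite (bigID (fun r => ri r == k)) /= big1 ?add0m => [|r]; last first.
  by case/andP => /P2 P2r /eqP rik; rewrite /top_mon rik (negPf (P2r rik)).
by apply: eq_bigl => r; have [_|/P1 ->] := eqVneq (ri r) k; rewrite ?andbF.
Qed.

(** The rows other than [r] are the coordinates of the family [bumped A a (ri r)],
    which is independent, and the row [r] is the spare unit vector. *)
Lemma det_top_neq0 r : rj r = a (ri r) ->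
  \det (\matrix_(r', c) if r' == r then (c == l)%:R else top_row r' 0 c) != 0.
Proof.
move=> top_r; set H := (\matrix_(r', c) _).
apply/negP => /det0P [v v0 vH]; case/eqP: v0.
have [q qdual] := dualA (ri_in r).
pose y := \sum_(r' | r' != r) v 0 r' *: nat_row (ri r') (rj r').
have yQ c : v 0 r * (c == l)%:R + (y *m Q) 0 c = 0.
  have -> : (y *m Q) 0 c = \sum_(r' | r' != r) v 0 r' * top_row r' 0 c.
    rewrite mulmx_suml summxE; apply: eq_bigr => r' _.
    by rewrite -scalemxAl mxE.
  move/matrixP/(_ 0 c): vH; rewrite mxE (bigD1 r) //= [RHS]mxE mxE eqxx => vHc.
  rewrite -[RHS]vHc; congr (_ + _); apply: eq_bigr => r' /negPf r'r.
  by rewrite [H _ _]mxE r'r.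
have vr : v 0 r = 0.
  have := yQ l; rewrite eqxx mulr1 mxE big1 ?addr0 // => i _; by rewrite Ql mulr0.
have y0 : y = 0.
  rewrite -[y]QP; last by apply: summx_sub => r' _; apply/scalemx_sub/nat_row_sub/ri_in.
  suff -> : y *m Q = 0 by rewrite mul0mx.
  by apply/rowP => c; have := yQ c; rewrite vr mul0r add0r => ->; rewrite mxE.
have bump_lt (r' : 'I_s) : r' != r -> (rj r' < bumped A a (ri r) (ri r'))%N.
  move=> r'r; rewrite /bumped ri_in; have [eq_i|_] := eqVneq (ri r') (ri r); last first.
    by rewrite addn1 ltnS rj_le.
  rewrite addn0 ltn_neqAle rj_le andbT; apply: contraNneq r'r => eq_j.
  by apply/eqP/rel_index_inj => //; rewrite eq_j top_r eq_i.
have rown (r' : 'I_s) (r'r : r' != r) : exists2 j : 'I_n, nat_of_ord j = rj r' &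
    nat_row (ri r') (rj r') = w (ri r') j.
  have lt_n := leq_trans (bump_lt _ r'r) (bumped_le (ri_in r) _).
  by exists (Ordinal lt_n) => //; rewrite -nat_rowE.
apply/rowP => r0; rewrite mxE; have [->//|r0r] := eqVneq r0 r.
have [j0 ej0 _] := rown r0 r0r.
have /matrixP/(_ 0 0) : y *m q (ri r0) j0 = 0 by rewrite y0 mul0mx.
rewrite mulmx_suml summxE (bigD1 r0) //= big1 => [|r' /andP[r'r r'r0]]; last first.
  have [j ej ->] := rown r' r'r.
  rewrite -scalemxAl qdual ?ej ?ej0 ?bump_lt // !mxE.
  case: andP => [[/eqP eqi /eqP eqj]|_]; last by rewrite mulr0.
  by case/eqP: r'r0; apply: rel_index_inj; rewrite // -ej -ej0 eqj.
have [j ej ->] := rown r0 r0r.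
rewrite addr0 -scalemxAl qdual ?ej ?ej0 ?bump_lt // !mxE eqxx.
have -> : j = j0 by apply: val_inj; rewrite /= ej ej0.
by rewrite !eqxx mulr1n mulr1.
Qed.

Lemma relation_coef_top k r : ri r = k -> rj r = a k ->
  exists2 d, d != 0 & dominated (top_mons k) d (relation_coef r).
Proof.
move=> eqk eqj.
exists (\det (\matrix_(r', c) if r' == r then (c == l)%:R else top_row r' 0 c)).
  by apply: det_top_neq0; rewrite eqk.
rewrite -(@top_monsE k (fun r' => r' != r)).
- by apply: relation_coef_dominated => r' c _; apply: rel_mx_dominated.
- by move=> r'; apply: contraNneq => ->; rewrite eqk.
- by move=> r' r'r eqk'; apply: contraNneq r'r => eqj'; apply/eqP/rel_index_inj; rewrite ?eqk ?eqj.
Qed.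

Lemma rel_mx_dominated_below r c (j : 'I_n) :
  rj r = a (ri r) -> (j < a (ri r))%N -> dominated (U (ri r) j) 0 (rel_mx r c).
Proof.
move=> eqj lt_ja; rewrite [X in dominated _ _ X]mxE.
apply: dominated_sum0 => // j' _; rewrite /rel_entry eqj ltnn.
case: ifP => [le_aj|_]; last by rewrite scaler0; apply: dominated0.
exact: dominated_var_lt (leq_trans lt_ja le_aj).
Qed.

(** All monomials of [v_k] lie strictly below [x_kj], so giving that row the bound
    [x_kj] and the leading vector 0 yields a strict bound on the determinant. *)
Lemma relation_coef_low k r (j : 'I_n) : ri r = k -> rj r = j -> (j < a k)%N ->
  dominated (top_mons k + U k j)%MM 0 (relation_coef r).
Proof.
move=> eqk eqj lt_ja.
have [r1 [eqk1 eqj1]] : exists r1 : 'I_s, ri r1 = k /\ rj r1 = a k.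
  by apply: rel_index_exists => //; rewrite -eqk ri_in.
have r1r : r1 != r by apply: contraTneq lt_ja => r1r; rewrite -eqj1 r1r eqj ltnn.
have := @relation_coef_dominated r (fun r' => if r' == r1 then U k j else top_mon r')
  (fun r' => if r' == r1 then 0 else top_row r').
rewrite (bigD1 r1) //= eqxx addmC.
have -> : (\sum_(r' | (r' != r) && (r' != r1)) (if r' == r1 then U k j else top_mon r'))%MM
          = top_mons k.
  rewrite -(@top_monsE k (fun r' => (r' != r) && (r' != r1))).
  - by apply: eq_bigr => r' /andP[_ /negPf ->].
  - by move=> r' neqk; apply/andP; split; apply: contraNneq neqk => ->; rewrite ?eqk ?eqk1.
  - move=> r' /andP[_ r'r1] eqk'; apply: contraNneq r'r1 => eqj'.
    by apply/eqP/rel_index_inj; rewrite ?eqk1 ?eqj1.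
have -> : \det (\matrix_(r', c) if r' == r then (c == l)%:R
    else (if r' == r1 then 0 else top_row r') 0 c) = 0.
  rewrite (expand_det_row _ r1) big1 // => c _; rewrite mxE (negPf r1r) eqxx.
  by rewrite mxE mul0r.
apply=> r' c r'r; case: eqP => [->|_]; last exact: rel_mx_dominated.
by rewrite [X in dominated _ X]mxE -eqk1; apply: rel_mx_dominated_below; rewrite ?eqk1.
Qed.

Definition top_mons_of i : 'X_{1..(m * n)} := if i \in A then top_mons i else 0%MM.

(** Up to the factor [top_mons_of i], which depends on [i] only, the substitution
    keeps [x_ij] as a leading monomial for [j >= a i] and replaces it by strictly
    smaller monomials for [j < a i]. *)
Lemma collapse_mx_dominated i (j : 'I_n) : exists c,
  dominated (top_mons_of i + U i j)%MM c (collapse_mx i j) /\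
  (~~ ((i \in A) && (j < a i)%N) -> c != 0).
Proof.
rewrite [collapse_mx i j]mxE /top_mons_of; have [iA|_] := ifPn; last first.
  by exists 1; rewrite add0m; split=> [|_]; [exact: dominatedX|exact: oner_neq0].
have single (r0 : 'I_s) : ri r0 = i ->
    (forall r, ri r = i -> r != r0 -> rel_entry i (rj r) j = 0) ->
    \sum_(r | ri r == i) relation_coef r * rel_entry i (rj r) j
      = relation_coef r0 * rel_entry i (rj r0) j.
  move=> ri0 other; rewrite (bigD1 r0) /= ?ri0 // big1 ?addr0 // => r /andP[/eqP rii rr0].
  by rewrite other ?mulr0.
have [lt_ja|le_aj] := ltnP j (a i).
  have [r0 [ri0 rj0]] := rel_index_exists iA (ltnW lt_ja).
  rewrite (single r0) // => [|r rii rr0]; last first.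
    rewrite /rel_entry; case: ifP => [_|_]; last by rewrite leqNgt lt_ja.
    case: eqP => // eqj; case/eqP: rr0; apply: rel_index_inj; first by rewrite rii ri0.
    by rewrite rj0.
  exists 0; split=> //; rewrite /rel_entry rj0 lt_ja eqxx mulr1.
  exact: relation_coef_low.
have [r0 [ri0 rj0]] := rel_index_exists iA (leqnn _).
rewrite (single r0) // => [|r rii rr0]; last first.
  have lt_r : (rj r < a i)%N.
    rewrite ltn_neqAle -{2}rii rj_le andbT; apply: contraNneq rr0 => eqj.
    by apply/eqP/rel_index_inj; rewrite ?ri0 ?rj0.
  by rewrite /rel_entry lt_r gtn_eqF // (leq_trans lt_r).
have [d d0 dom_d] := relation_coef_top ri0 rj0.
exists d; split=> //; rewrite /rel_entry rj0 ltnn le_aj -[d]mulr1.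
exact: dominatedM dom_d (dominatedX _ le_order _).
Qed.

(** The collapsing substitution kills [f]. On a multihomogeneous [f] it multiplies
    all leading monomials by the same factor [shift]. If [t] only involved
    variables whose leading monomial is kept, the image of [f] would have the
    nonzero coefficient [f@_t * cu t] at [shift + t]. *)
Lemma lead_mon_below f t : max_minors_ideal (forms_mx w) f ->
  graded_piece (mono_deg t) f -> is_lead_mon le f t ->
  exists i (j : 'I_n), [/\ i \in A, (j < a i)%N & (0 < t (mxvec_index i j))%N].
Proof.
move=> fI ft [tf le_t]; apply: contrapT => none.
have /choice [c cP] : forall p : 'I_m * 'I_n, exists c,
    dominated (top_mons_of p.1 + U p.1 p.2)%MM c (collapse_mx p.1 p.2) /\
    (~~ ((p.1 \in A) && (p.2 < a p.1)%N) -> c != 0).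
  by move=> p; apply: collapse_mx_dominated.
(* The exponent of [top_mons_of i] is the degree in block [i], common to all monomials. *)
pose shift : 'X_{1..(m * n)} :=
  (\sum_i top_mons_of i *+ \sum_(j < n) t (mxvec_index i j))%MM.
pose cu (u : 'X_{1..(m * n)}) := \prod_i \prod_j c (i, j) ^+ u (mxvec_index i j).
have dom_u u : u \in msupp f ->
    dominated (shift + u)%MM (cu u) (subst_mx collapse_mx 'X_[u]).
  move=> uf; have /mono_degP eq_deg := ft u uf.
  have -> : (shift + u = \sum_i \sum_(j < n)
      (top_mons_of i + U i j) *+ u (mxvec_index i j))%MM.
    apply/mnmP => k; rewrite mnmDE !mnm_sumE.
    have -> : u k = (\sum_i \sum_(j < n) U i j k * u (mxvec_index i j))%N.
      rewrite {1}[u]multinomUE_id mnm_sumE big_mxvec; apply: eq_bigr => i _.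
      by apply: eq_bigr => j _; rewrite mulmnE.
    rewrite -big_split; apply: eq_bigr => i _ /=.
    rewrite mulmnE -eq_deg big_distrr -big_split mnm_sumE.
    by apply: eq_bigr => j _; rewrite mulmnE mnmDE mulnDl.
  rewrite subst_mpolyX; apply: dominated_prod => // i _.
  apply: dominated_prod => // j _; apply: dominatedXn => //; exact: (cP (i, j)).1.
have : dominated (shift + t)%MM (f@_t * cu t) (subst_mx collapse_mx f).
  rewrite subst_mpolyE (bigD1_seq t) ?msupp_uniq //= -[X in dominated _ X]addr0.
  apply: dominatedD => //; first by apply: dominatedZ => //; apply: dom_u.
  rewrite big_seq_cond; apply: dominated_sum0 => // u /andP[uf ut]; rewrite -[0](mulr0 f@_u).
  apply: dominatedZ => //; apply: (dominated_weaken le_order (dom_u u uf)).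
    by apply: mo_addD => //; [apply: mo_refl|apply: le_t].
  by rewrite eqm_add2l.
case; rewrite collapse_kills_minors // mcoeff0 => /esym/eqP; rewrite mulf_eq0.
rewrite mcoeff_msupp in tf; rewrite (negPf tf) /= => /prodf_eq0 [i _ /prodf_eq0 [j _]].
rewrite expf_eq0 => /andP[tij /eqP cij] _; apply: none; exists i, j.
by have := (cP (i, j)).2; rewrite cij eqxx /=; case: andP => [[]|_ /(_ isT)].
Qed.

End UpperBound.

(** * Leading monomials of the ideal of maximal minors *)

Section MaximalMinors.
Variables (R : comNzRingType) (m n : nat).

(** Cauchy-Binet before the terms are grouped by their sets of columns. *)
Lemma det_mulmx_colsub (A : 'M[R]_(m, n)) (C : 'M[R]_(n, m)) :
  \det (A *m C) =
  \sum_(h : {ffun 'I_m -> 'I_n}) (\prod_k C (h k) k) * \det (colsub h A).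
Proof.
rewrite -det_tr.
transitivity (\sum_(s : {perm 'I_m}) \sum_(h : {ffun 'I_m -> 'I_n})
    (-1) ^+ s * \prod_k (A (s k) (h k) * C (h k) k)).
  apply: eq_bigr => s _; rewrite -big_distrr /=; congr (_ * _).
  rewrite -(bigA_distr_bigA (fun k j => A (s k) j * C j k)) /=.
  by apply: eq_bigr => k _; rewrite !mxE.
rewrite exchange_big; apply: eq_bigr => h _ /=.
rewrite -det_tr /determinant big_distrr /=; apply: eq_bigr => s _.
rewrite big_split /= mulrA mulrC; congr (_ * (_ * _)).
by apply: eq_bigr => k _; rewrite !mxE.
Qed.

Lemma sort_injection (h : 'I_m -> 'I_n) : injective h ->
  exists s : {perm 'I_m}, {homo (h \o s) : i j / (i < j)%N}.
Proof.
move=> inj_h; pose X := [set h i | i in 'I_m].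
have cardX : m = #|X| by rewrite card_imset // card_ord.
pose g (i : 'I_m) : 'I_n := Order.enum_val (cast_ord cardX i).
have gX i : exists k, g i == h k.
  have /imsetP [k _ gk] := Order.enum_valP (cast_ord cardX i).
  by exists k; apply/eqP; rewrite -gk.
have g_mono i j : (g i <= g j)%N = (i <= j)%N.
  have := Order.le_enum_val (@le_total _ 'I_n) (cast_ord cardX i) (cast_ord cardX j).
  by rewrite !leEord.
pose s0 i := xchoose (gX i).
have s0E i : h (s0 i) = g i by apply/esym/eqP/(xchooseP (gX i)).
have inj_s0 : injective s0.
  move=> i j eq_s; apply: val_inj; apply/eqP; rewrite eqn_leq /= -!g_mono.
  by rewrite -!s0E eq_s leqnn.
exists (perm inj_s0) => i j; rewrite /= !permE !s0E.
by rewrite !ltnNge g_mono.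
Qed.

End MaximalMinors.

Section MinorsIdeal.
Variables (K : fieldType) (m n : nat).
Local Notation S := {mpoly K[m * n]}.

(** A choice of columns with a repetition has determinant 0, and any other one is
    increasing after a permutation, which only changes the sign. *)
Lemma minor_in_ideal (L : 'M[S]_(m, n)) (h : 'I_m -> 'I_n) :
  max_minors_ideal L (\det (colsub h L)).
Proof.
have [I0 _ IM] := ideal_gen_ideal
  [set \det (colsub f L) | f in [set f : 'I_m -> 'I_n | {homo f : i j / (i < j)%N}]]%classic.
have [inj_h|ninj_h] := pselect (injective h); last first.
  suff -> : \det (colsub h L) = 0 by exact: I0.
  have [i [j [ij eq_h]]] : exists i j, i != j /\ h i = h j.
    apply: contrapT => none; apply: ninj_h => i j eq_h; apply/eqP.
    by apply/negPn/negP => ij; apply: none; exists i, j.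
  rewrite -det_tr; apply: (determinant_alternate ij) => k.
  by rewrite !mxE eq_h.
have [s hs] := sort_injection inj_h.
have -> : \det (colsub h L) = (-1) ^+ s * \det (colsub (h \o s) L).
  have -> : colsub (h \o s) L = col_perm s (colsub h L).
    by apply/matrixP => i j; rewrite !mxE.
  by rewrite col_permE det_mulmx det_perm odd_permV mulrC -mulrA -signr_addb addbb mulr1.
by apply: IM; apply: sub_ideal_gen; exists (h \o s).
Qed.

Lemma det_mulmx_in_ideal (L : 'M[S]_(m, n)) (C : 'M[S]_(n, m)) :
  max_minors_ideal L (\det (L *m C)).
Proof.
rewrite det_mulmx_colsub; apply: ideal_sum => [|h _]; first exact: ideal_gen_ideal.
by apply: (@ideal_mul _ (max_minors_ideal L)); [exact: ideal_gen_ideal|exact: minor_in_ideal].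
Qed.

Lemma mono_deg_var (i : 'I_m) (j : 'I_n) :
  mono_deg U_(mxvec_index i j)%MM = delta_mx 0 i.
Proof.
apply/rowP => k; rewrite !mxE eqxx /=; under eq_bigr do rewrite mnm1E eq_mxvec_index.
case: eqP => [->|/eqP /negPf ik]; last by rewrite eq_sym ik big1 // => l _; rewrite ik.
by rewrite (bigD1 j) //= !eqxx big1 // => l; rewrite eq_sym => /negPf ->.
Qed.

Lemma max_minors_graded (w : 'I_m -> 'I_n -> 'rV[K]_n) :
  is_graded (max_minors_ideal (forms_mx w)).
Proof.
apply: ideal_gen_graded => _ [h _ <-].
exists (\sum_i delta_mx 0 i); apply: graded_piece_sum => s _.
have -> : (-1) ^+ s = ((-1) ^+ s)%:MP :> S by rewrite rmorph_sign.
rewrite mul_mpolyC; apply: graded_pieceZ.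
apply: graded_piece_prod => i _; rewrite !mxE; apply: graded_piece_sum => j _.
by apply: graded_pieceZ; rewrite -(mono_deg_var i j); apply: graded_pieceX.
Qed.

End MinorsIdeal.

Section LeadMonomials.
Variables (K : fieldType) (m n : nat).
Local Notation S := {mpoly K[m * n]}.
Local Notation U i j := (U_(mxvec_index i j)%MM : 'X_{1..(m * n)}).

(** Divisibility by the generator [x_(1, a 1) ... x_(m, a m)] reads off one exponent in
    each block, since its factors lie in distinct blocks. *)
Definition gin_mon (b : {set 'I_m} -> nat) (t : 'X_{1..(m * n)}) :=
  exists a : 'I_m -> 'I_n, (forall A : {set 'I_m}, (\sum_(i in A) (a i).+1 <= b A)%N) /\
    forall i, (0 < t (mxvec_index i (a i)))%N.

(** The value [s = n] stands for the absence of variables of degree [e_i] in [t]. *)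
Lemma first_var (t : 'X_{1..(m * n)}) (i : 'I_m) : exists s,
  [/\ (s <= n)%N, forall j : 'I_n, (j < s)%N -> t (mxvec_index i j) = 0%N &
      (s < n)%N -> exists2 j : 'I_n, nat_of_ord j = s & (0 < t (mxvec_index i j))%N].
Proof.
have [j0 tj0|none] := pickP (fun j : 'I_n => 0 < t (mxvec_index i j))%N; last first.
  exists n; rewrite ltnn; split=> // j _; apply/eqP.
  by have := none j; rewrite lt0n => /negbFE.
have [j tj minj] := @arg_minnP _ j0 (fun j : 'I_n => 0 < t (mxvec_index i j))%N val tj0.
exists j; split=> [|k ltkj|_]; [exact: ltnW| |by exists j].
apply/eqP; rewrite -leqn0 leqNgt; apply/negP => /minj /=.
by rewrite leqNgt ltkj.
Qed.

(** The 0-based position [s i] of the first variable of [t] in block [i] must violate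
    some inequality, for otherwise [s i < n] for all [i] and these variables give a
    generator dividing [t]. *)
Lemma not_gin_mon (b : {set 'I_m} -> nat) t :
  (forall A B : {set 'I_m}, A \subset B -> b A <= b B)%N ->
  (forall A, b A <= n)%N -> ~ gin_mon b t ->
  exists (A : {set 'I_m}) (a : 'I_m -> nat),
  [/\ forall i (j : 'I_n), (j < a i)%N -> t (mxvec_index i j) = 0%N,
      forall i, i \notin A -> a i = 0%N,
      (\sum_(i in A) (a i).+1 = (b A).+1)%N &
      forall k, k \in A -> forall B : {set 'I_m}, (\sum_(i in B) bumped A a k i <= b B)%N].
Proof.
move=> mono_b b_le not_gin.
have /choice [s sP] := first_var t.
have [/existsP [A viol]|noviol] :=
  boolP [exists A : {set 'I_m}, (b A < \sum_(i in A) (s i).+1)%N].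
  have [A' [a [a_s a0 sumA bumpA]]] := minimal_violation mono_b viol.
  exists A', a; split=> // i j lt_ja; have [_ before _] := sP i.
  exact: before (leq_trans lt_ja (a_s i)).
have le_s (A : {set 'I_m}) : (\sum_(i in A) (s i).+1 <= b A)%N.
  by rewrite leqNgt; apply: contra noviol => viol; apply/existsP; exists A.
have lt_sn i : (s i < n)%N.
  by have := le_s [set i]; rewrite big_set1 => /leq_trans; apply.
case: not_gin; exists (fun i => Ordinal (lt_sn i)); split=> [A|i]; first exact: le_s.
have [_ _ /(_ (lt_sn i)) [j eq_j tj]] := sP i.
by have <- : j = Ordinal (lt_sn i) by apply: val_inj.
Qed.

Variables (w : 'I_m -> 'I_n -> 'rV[K]_n) (M : 'I_m -> 'M[K]_n).
Hypothesis wM : forall i j, (w i j <= M i)%MS.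
Hypothesis dual_w : forall a, rado_cond M a -> dual_family w a.

Variable le : rel 'X_{1..(m * n)}.
Hypothesis le_order : monomial_order le.
Hypothesis le_var : forall i (j k : 'I_n), (j < k)%N ->
  le U_(mxvec_index i k)%MM U_(mxvec_index i j)%MM.

Definition sum_rank (A : {set 'I_m}) := \rank (\sum_(i in A) M i)%MS.

(** Replacing the columns of the matrix by their combinations with the dual vectors
    of [w i (a i)] gives a square matrix in which the variables [x_ij] with
    [j < a i] have disappeared and [x_(i, a i)] survives only on the diagonal. Its
    determinant has leading monomial the product of the [x_(i, a i)]. *)
Lemma gin_mon_is_lead t : gin_mon sum_rank t ->
  exists2 f, max_minors_ideal (forms_mx w) f & is_lead_mon le f t.
Proof.
case=> a [rado_a ta].
have [q qdual] := dual_w rado_a.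
pose C : 'M[S]_(n, m) := map_mx (@mpolyC _ K) (\matrix_(c, k) q k (a k) c 0).
have det_dom : dominated le (\sum_i U i (a i))%MM 1 (\det (forms_mx w *m C)).
  rewrite -(det1 K m); apply: dominated_det => // i k.
  have -> : (forms_mx w *m C) i k = \sum_j (w i j *m q k (a k)) 0 0 *: xvar K i j.
    rewrite mxE; under eq_bigr do rewrite !mxE big_distrl /=.
    rewrite exchange_big; apply: eq_bigr => j _ /=.
    rewrite mxE scaler_suml; apply: eq_bigr => c _.
    by rewrite mulrC mul_mpolyC scalerA mulrC.
  (* Row [i] is bounded by [x_(i, a i)], with the identity as leading matrix. *)
  rewrite (bigD1 (a i)) //= -[X in dominated _ _ X]addr0; apply: dominatedD => //.
    rewrite qdual ?ltnS // -[X in dominated _ _ X]mulr1 !mxE.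
    have -> : (i == k) && (a i == a k) = (i == k).
      by have [->|] := eqVneq i k; rewrite ?eqxx.
    exact: dominatedZ (dominatedX _ le_order _).
  apply: dominated_sum0 => // j ji.
  have [lt_ja|lt_aj|eq_ja] := ltngtP j (a i).
  - rewrite qdual ?ltnS ?(ltnW lt_ja) // !mxE.
    have -> : (i == k) && (j == a k) = false.
      by apply/negbTE; apply: contraNN ji => /andP[/eqP -> ].
    by rewrite scale0r; apply: dominated0.
  - exact: dominated_var_lt.
  - by case/eqP: ji; apply: val_inj.
have tE : t = (t - (\sum_i U i (a i)) + \sum_i U i (a i))%MM.
  rewrite submK //; apply/mnm_lepP => k; rewrite mnm_sumE.
  case/mxvec_indexP: k => i j; rewrite (bigD1 i) //= mnm1E eq_mxvec_index eqxx /=.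
  rewrite big1 ?addn0 => [|i' /negPf i'i]; last by rewrite mnm1E eq_mxvec_index i'i.
  by case: eqP => // <-.
have [] := dominatedM le_order (dominatedX K le_order (t - \sum_i U i (a i))%MM) det_dom.
rewrite -tE mulr1 => coef1 le_t.
exists ('X_[t - \sum_i U i (a i)] * \det (forms_mx w *m C)).
  by apply: (@ideal_mul _ (max_minors_ideal _)); [exact: ideal_gen_ideal|exact: det_mulmx_in_ideal].
by split; rewrite // mcoeff_msupp coef1 oner_neq0.
Qed.

(** A monomial outside the claimed set avoids the variables [x_ij] with [j < a i]
    for a minimal violation [a], which [lead_mon_below] forbids. *)
Lemma lead_is_gin_mon f t :
  max_minors_ideal (forms_mx w) f -> is_lead_mon le f t -> gin_mon sum_rank t.
Proof.
move=> fI [tf le_t]; apply: contrapT => not_gin.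
have sum_rank_mono (A B : {set 'I_m}) : A \subset B -> (sum_rank A <= sum_rank B)%N.
  move=> AB; apply/mxrankS/sumsmx_subP => i iA.
  by apply: (sumsmx_sup i) => //; apply: (fintype.subsetP AB).
have sum_rank_le A : (sum_rank A <= n)%N by apply: rank_leq_col.
have [A [a [t0 a0 sumA bumpA]]] := not_gin_mon sum_rank_mono sum_rank_le not_gin.
have bump_n k : k \in A -> forall i, (bumped A a k i <= n)%N.
  move=> kA i; have := bumpA k kA [set i]; rewrite big_set1 => /leq_trans; apply.
  exact: sum_rank_le.
have dualA k : k \in A -> dual_family w (bumped A a k).
  by move=> kA; apply: dual_w; apply: bumpA.
have lt_rank : (\rank (\sum_(i in A) M i)%MS < #|rel_index n A a|)%N.
  by rewrite (card_rel_index sumA).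
have [Q [P [l [QP Ql]]]] := coordinates lt_rank.
pose f' := component (mono_deg t) f.
have f't u : u \in msupp f' -> u \in msupp f.
  by rewrite !mcoeff_msupp mcoeff_component; case: ifP; rewrite ?eqxx.
have f'I : max_minors_ideal (forms_mx w) f' by apply: max_minors_graded.
have lead' : is_lead_mon le f' t.
  split=> [|u /f't /le_t //].
  by rewrite mcoeff_msupp mcoeff_component eqxx -mcoeff_msupp.
have [i [j [_ lt_ja]]] :=
  lead_mon_below wM sumA bump_n dualA QP Ql le_order le_var f'I (@component_in _ _ _ _ _) lead'.
by rewrite t0.
Qed.

End LeadMonomials.

(** * Dimensions of spans *)

Section Dimensions.
Variables (K : fieldType) (V : lmodType K).

Lemma span_coords d d' (b : 'I_d -> V) (b' : 'I_d' -> V) :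
  (lin_span b `<=` lin_span b')%classic ->
  exists C : 'M[K]_(d, d'), forall i, b i = \sum_j C i j *: b' j.
Proof.
move=> sub_span.
have /choice [C CP] : forall i, exists c : 'I_d' -> K, b i = \sum_j c j *: b' j.
  move=> i; have [|c _ eq_b] := sub_span (b i); last by exists c.
  exists (fun k => (k == i)%:R) => //.
  rewrite (bigD1 i) //= eqxx scale1r big1 ?addr0 // => k /negPf ->; exact: scale0r.
by exists (\matrix_(i, j) C i j) => i; rewrite CP; apply: eq_bigr => j _; rewrite mxE.
Qed.

Lemma has_dim_le (W : set V) d d' : has_dim W d -> has_dim W d' -> (d <= d')%N.
Proof.
move=> [b [indep_b span_b]] [b' [indep_b' span_b']].
have [|C CP] := @span_coords _ _ b b'; first by rewrite span_b span_b'.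
have [|C' CP'] := @span_coords _ _ b' b; first by rewrite span_b span_b'.
have CC' : C *m C' = 1%:M.
  apply/matrixP => i k; apply/eqP; rewrite -subr_eq0; apply/eqP.
  move: k; apply: indep_b.
  under eq_bigr do rewrite scalerBl; rewrite sumrB; apply/eqP; rewrite subr_eq0; apply/eqP.
  rewrite [RHS](bigD1 i) //= mxE eqxx scale1r [X in _ = _ + X]big1 => [|k /negPf ik]; last first.
    by rewrite mxE eq_sym ik scale0r.
  rewrite addr0 [RHS]CP.
  under [RHS]eq_bigr do rewrite CP' scaler_sumr; rewrite exchange_big /=.
  apply: eq_bigr => k _; rewrite mxE scaler_suml; apply: eq_bigr => j _.
  by rewrite scalerA.
have := mxrankM_maxr C C'; rewrite CC' mxrank1 => /leq_trans; apply.
exact: rank_leq_row.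
Qed.

Lemma subdimE (W : set V) d : has_dim W d -> subdim W = d.
Proof.
move=> dimW; rewrite /subdim; case: xgetP => [d' -> dimW'|/(_ d)//].
by apply/eqP; rewrite eqn_leq !(has_dim_le (W := W)).
Qed.

(** A complement of the kernel of [N] maps isomorphically onto the span. *)
Lemma has_dim_rank n (b : 'I_n -> V) (N : 'M[K]_n) :
  (forall v : 'rV[K]_n, \sum_c v 0 c *: b c = 0 <-> v *m N = 0) ->
  has_dim (lin_span b) (\rank N).
Proof.
move=> kerN.
pose B := row_base (kermx N)^C%MS.
have -> : \rank N = \rank (kermx N)^C%MS.
  by rewrite mxrank_compl mxrank_ker subKn // rank_leq_row.
pose b' i := \sum_c B i c *: b c.
have comb (e : 'rV[K]_(\rank (kermx N)^C%MS)) :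
    \sum_i e 0 i *: b' i = \sum_c (e *m B) 0 c *: b c.
  under eq_bigr do rewrite scaler_sumr; rewrite exchange_big; apply: eq_bigr => c _ /=.
  by rewrite mxE scaler_suml; apply: eq_bigr => i _; rewrite scalerA.
exists b'; split=> [e e0 i|].
  pose ev := \row_i e i.
  have : \sum_c (ev *m B) 0 c *: b c = 0.
    by rewrite -comb -[RHS]e0; apply: eq_bigr => k _; rewrite mxE.
  move/kerN/sub_kermxP => subker.
  have subC : (ev *m B <= (kermx N)^C)%MS by rewrite (submx_trans (submxMl _ _)) ?eq_row_base.
  have /eqP : ev *m B = 0.
    apply/eqP; rewrite -submx0 -(capmx_compl (kermx N)) sub_capmx subker; exact: subC.
  rewrite mulmx_free_eq0 ?row_base_free // => /eqP/rowP/(_ i).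
  by rewrite !mxE.
apply/seteqP; split=> [_ [e _ <-]|_ [v _ <-]].
  exists (fun c => ((\row_i e i) *m B) 0 c) => //; rewrite -comb.
  by apply: eq_bigr => i _; rewrite mxE.
have : (\row_c v c <= kermx N + (kermx N)^C)%MS by rewrite submx_full // addsmx_compl_full.
case/sub_addsmxP => -[v1 v2] /= eqv.
have : (v2 *m (kermx N)^C <= B)%MS by rewrite eq_row_base submxMl.
case/submxP => e eq_e; exists (fun i => e 0 i) => //; rewrite comb -eq_e.
have /kerN : v1 *m kermx N *m N = 0 by rewrite -mulmxA mulmx_ker mulmx0.
move=> v1_0; transitivity (\sum_c (v1 *m kermx N) 0 c *: b c
    + \sum_c (v2 *m (kermx N)^C%MS) 0 c *: b c); first by rewrite v1_0 add0r.
rewrite -big_split; apply: eq_bigr => c _ /=.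
by rewrite -scalerDl; congr (_ *: _); move/rowP/(_ c): eqv; rewrite !mxE.
Qed.

Lemma has_dim_image (V' : lmodType K) (W : set V) d (phi : {linear V -> V'}) :
  injective phi -> has_dim W d -> has_dim (phi @` W)%classic d.
Proof.
move=> inj_phi [b [indep_b span_b]].
have comb (c : 'I_d -> K) : \sum_i c i *: (phi \o b) i = phi (\sum_i c i *: b i).
  by rewrite linear_sum; apply: eq_bigr => i _; rewrite linearZ.
exists (phi \o b); split=> [c|].
  by rewrite comb => phi0; apply: indep_b; apply: inj_phi; rewrite linear0.
rewrite -span_b; apply/seteqP; split=> [_ [c _ <-]|_ [_ [c _ <-] <-]].
  by rewrite comb; exists (\sum_i c i *: b i) => //; exists c.
by exists c.
Qed.

End Dimensions.

(** * Dimensions from leading monomials *)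

Section LeadDimension.
Variables (K : fieldType) (m n : nat) (le : rel 'X_{1..(m * n)}).
Hypothesis le_order : monomial_order le.
Local Notation S := {mpoly K[m * n]}.

Lemma exists_max (s : seq 'X_{1..(m * n)}) t0 :
  t0 \in s -> exists2 t, t \in s & forall u, u \in s -> le u t.
Proof.
have [tot _ tr _] := le_order; elim: s t0 => // x s IHs t0 _.
have [->|[t1 t1s]] : s = [::] \/ exists t, t \in s.
  by case: (s) => [|y s']; [left|right; exists y; rewrite inE eqxx].
  by exists x; rewrite ?inE ?eqxx // => u; rewrite inE => /eqP ->; apply: mo_refl.
have [t ts max_t] := IHs _ t1s.
case/orP: (tot x t) => [xt|tx].
  by exists t; rewrite ?inE ?ts ?orbT // => u /predU1P[->|/max_t].
exists x; rewrite ?inE ?eqxx // => u /predU1P[->|/max_t ut]; first exact: mo_refl.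
exact: tr tx.
Qed.

Lemma exists_lead (f : S) : f != 0 -> exists t, is_lead_mon le f t.
Proof.
by move=> /mlead_supp /exists_max [t tf max_t]; exists t.
Qed.

(** Elements [b i] with the leading monomials listed in [E] are independent, and an
    element is determined by its coefficients on [E]. Hence the square matrix of
    these coefficients for the [b i] is invertible, and the [b i] span. *)
Lemma has_dim_lead (W : set S) (E : seq 'X_{1..(m * n)}) :
  W 0 -> (forall f g, W f -> W g -> W (f + g)) -> (forall c f, W f -> W (c *: f)) ->
  uniq E ->
  (forall t, t \in E -> exists2 f, W f & is_lead_mon le f t) ->
  (forall f t, W f -> is_lead_mon le f t -> t \in E) ->
  has_dim W (size E).
Proof.
move=> W0 WD WZ uniqE leadE leadW.
have [_ anti _ _] := le_order.
pose e i := tnth (in_tuple E) i.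
have eE i : e i \in E by apply: mem_tnth.
have e_inj : injective e by apply/tuple_uniqP.
have /choice [b bP] : forall i, exists f, W f /\ is_lead_mon le f (e i).
  by move=> i; have [f Wf lf] := leadE _ (eE i); exists f.
have Wsum (c : 'I_(size E) -> K) : W (\sum_i c i *: b i).
  by apply: big_ind => // i _; apply: WZ; case: (bP i).
have coef0 f : W f -> (forall i, f@_(e i) = 0) -> f = 0.
  move=> Wf f0; apply/eqP; apply/negPn/negP => /exists_lead [t lead_t].
  have /tnthP [i ei] : t \in in_tuple E by apply: leadW lead_t.
  by case: lead_t; rewrite mcoeff_msupp ei -/(e i) f0 eqxx.
have indep_b : lin_indep b.
  move=> c sum0 i; apply/eqP; apply/negPn/negP => ci.
  have [|t ts max_t] := @exists_max [seq e j | j in [pred j | c j != 0]] (e i).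
    by apply: fintype.image_f; rewrite inE.
  have [k ck tk] := fintype.imageP ts; rewrite inE in ck.
  have /(congr1 (mcoeff t)) := sum0; rewrite mcoeff0 raddf_sum (bigD1 k) //=.
  rewrite big1 => [|j jk]; last first.
    rewrite mcoeffZ; have [->|cj] := eqVneq (c j) 0; first by rewrite mul0r.
    have [_ [_ max_j]] := bP j.
    have [tb|/memN_msupp_eq0 -> ] := boolP (t \in msupp (b j)); last by rewrite mulr0.
    case/eqP: jk; apply: e_inj; rewrite -tk; apply: anti; rewrite max_j // andbT.
    by apply: max_t; apply: fintype.image_f; rewrite inE.
  have [_ [tb _]] := bP k; move: tb; rewrite mcoeff_msupp addr0 mcoeffZ tk => tb.
  by move/eqP; rewrite mulf_eq0 (negPf ck) (negPf tb).
pose Mat : 'M[K]_(size E) := \matrix_(i, j) (b i)@_(e j).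
have comb (v : 'rV[K]_(size E)) j : (\sum_i v 0 i *: b i)@_(e j) = (v *m Mat) 0 j.
  by rewrite raddf_sum mxE; apply: eq_bigr => i _; rewrite /= mcoeffZ mxE.
have unitM : Mat \in unitmx.
  rewrite unitmxE unitfE; apply/negP => /det0P [v v0 vM].
  case/eqP: v0; apply/rowP => i; rewrite mxE.
  apply: (indep_b (fun i => v 0 i)); apply: coef0 => // j.
  by rewrite comb vM mxE.
exists b; split=> //; apply/seteqP; split=> [_ [c _ <-] //|f Wf].
pose c := (\row_j f@_(e j)) *m invmx Mat.
exists (fun i => c 0 i) => //; apply/esym/eqP; rewrite -subr_eq0; apply/eqP/coef0.
  by rewrite -scaleN1r; apply: WD => //; apply: WZ.
by move=> j; rewrite mcoeffB comb mulmxKV // mxE subrr.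
Qed.

End LeadDimension.

Section Hilbert.
Variables (K : fieldType) (m n : nat) (le : rel 'X_{1..(m * n)}).
Hypothesis le_order : monomial_order le.
Local Notation S := {mpoly K[m * n]}.

Definition deg_mons (P : 'X_{1..(m * n)} -> Prop) (a : 'rV[int]_m) : seq 'X_{1..(m * n)} :=
  [seq val u | u <- enum {: 'X_{1..(m * n) < (\sum_i absz (a 0%R i))%N.+1}}
             & (mono_deg (val u) == a) && asbool (P (val u))].

Lemma mem_deg_mons P a t : t \in deg_mons P a <-> mono_deg t = a /\ P t.
Proof.
split=> [/mapP [u]|[ta Pt]].
  by rewrite mem_filter => /andP[/andP[/eqP ua /asboolP Pu] _] ->.
have lt_t : (mdeg t < (\sum_i absz (a 0%R i))%N.+1)%N.
  rewrite ltnS mdegE big_mxvec -ta; apply: leq_sum => i _.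
  by rewrite mxE.
apply/mapP; exists (BMultinom lt_t) => //.
by rewrite mem_filter mem_enum /= ta eqxx andbT; apply/asboolP.
Qed.

Lemma has_dim_graded (I : set S) (P : 'X_{1..(m * n)} -> Prop) a :
  is_ideal I -> is_graded I ->
  (forall t, P t -> exists2 f, I f & is_lead_mon le f t) ->
  (forall f t, I f -> is_lead_mon le f t -> P t) ->
  has_dim (I `&` graded_piece a)%classic (size (deg_mons P a)).
Proof.
move=> idI grI leadP lead_inP; have [I0 ID IM] := idI.
apply: (has_dim_lead le_order) => //.
- by split=> //; apply: graded_piece0.
- by move=> f g [If fa] [Ig ga]; split; [exact: ID|exact: graded_pieceD].
- move=> c f [If fa]; split; last exact: graded_pieceZ.
  by rewrite -mul_mpolyC; apply: IM.
- rewrite map_inj_uniq; first by rewrite filter_uniq ?enum_uniq.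
  exact: val_inj.
- move=> t /mem_deg_mons [ta /leadP [f If [tf max_t]]].
  exists (component a f); first by split; [exact: grI|exact: component_in].
  split=> [|u]; first by rewrite mcoeff_msupp mcoeff_component ta eqxx -mcoeff_msupp.
  rewrite mcoeff_msupp mcoeff_component; case: ifP => [_|]; last by rewrite eqxx.
  by rewrite -mcoeff_msupp; apply: max_t.
- move=> f t [If fa] lead_t; apply/mem_deg_mons; split; last exact: lead_inP lead_t.
  by apply: fa; case: lead_t.
Qed.

End Hilbert.

(** * The monomial ideal and its components *)

Section MonomialIdeals.
Variables (K : fieldType) (m n : nat).
Local Notation S := {mpoly K[m * n]}.
Implicit Types (P : 'X_{1..(m * n)} -> Prop).

Definition mono_ideal P : set S := [set f | forall t, t \in msupp f -> P t]%classic.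

Definition up_closed P := forall t u, P t -> P (u + t)%MM.

Lemma mono_ideal_ideal P : up_closed P -> is_ideal (mono_ideal P).
Proof.
move=> upP; split=> [t|f g Pf Pg t|f g Pg t]; first by rewrite msupp0.
  by move=> /msuppD_le; rewrite mem_cat => /orP[/Pf|/Pg].
by move=> /msuppM_le /allpairsP[[u v] /= [_ /Pg Pv ->]]; apply: upP.
Qed.

Lemma mono_idealX P t : mono_ideal P 'X_[t] <-> P t.
Proof.
split=> [Pt|Pt u]; first by apply: Pt; rewrite msuppX inE.
by rewrite msuppX inE => /eqP ->.
Qed.

Lemma mono_ideal_graded P : is_graded (mono_ideal P).
Proof.
move=> f Pf a t; rewrite mcoeff_msupp mcoeff_component.
by case: ifP => [_|]; rewrite ?eqxx // -mcoeff_msupp; apply: Pf.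
Qed.

Lemma mono_ideal_genE P (G : set S) :
  up_closed P -> (G `<=` mono_ideal P)%classic ->
  (forall t, P t -> ideal_gen G 'X_[t]) -> ideal_gen G = mono_ideal P.
Proof.
move=> upP GP PG; apply/seteqP; split=> [|f Pf].
  by apply: ideal_gen_min => //; apply: mono_ideal_ideal.
rewrite [f]mpolyE big_seq; apply: ideal_sum => [|t /Pf Pt]; first exact: ideal_gen_ideal.
rewrite -mul_mpolyC; apply: (@ideal_mul _ (ideal_gen G)); [exact: ideal_gen_ideal|exact: PG].
Qed.

Lemma ideal_genXM (G : set S) t u : G 'X_[u] -> (u <= t)%MM -> ideal_gen G 'X_[t].
Proof.
move=> Gu le_ut; rewrite -(submK le_ut) mpolyXD.
by apply: (@ideal_mul _ (ideal_gen G)); [exact: ideal_gen_ideal|exact: sub_ideal_gen].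
Qed.

Lemma initial_idealE (le : rel 'X_{1..(m * n)}) (I : set S) P :
  monomial_order le -> is_ideal I ->
  (forall t, P t -> exists2 f, I f & is_lead_mon le f t) ->
  (forall f t, I f -> is_lead_mon le f t -> P t) ->
  initial_ideal le I = mono_ideal P.
Proof.
move=> le_order idI leadP lead_inP; apply: mono_ideal_genE.
- move=> t u /leadP [f If [tf max_t]].
  apply: (lead_inP ('X_[u] * f)); first exact: ideal_mul.
  have := dominatedM le_order (dominatedX K le_order u) (conj erefl max_t).
  by rewrite mul1r => -[coef_t max_ut]; split; rewrite // mcoeff_msupp coef_t -mcoeff_msupp.
- by move=> _ [f [t [If lead_t ->]]]; apply/mono_idealX; apply: lead_inP lead_t.
- move=> t /leadP [f If lead_t]; apply: sub_ideal_gen; by exists f, t.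
Qed.

Lemma mono_ideal_lead (le : rel 'X_{1..(m * n)}) P t :
  monomial_order le -> P t -> exists2 f, mono_ideal P f & is_lead_mon le f t.
Proof.
move=> le_order Pt; exists 'X_[t]; first exact/mono_idealX.
by split=> [|u]; rewrite msuppX inE // => /eqP ->; apply: mo_refl.
Qed.

Lemma gin_mon_up b : up_closed (@gin_mon m n b).
Proof.
by move=> t u [a [rado_a ta]]; exists a; split=> // i; rewrite mnmDE addn_gt0 ta orbT.
Qed.

Lemma gin_generatorsE b : ideal_gen (gin_generators K n b) = mono_ideal (gin_mon b).
Proof.
have prodE (a : 'I_m -> 'I_n) :
    \prod_i xvar K i (a i) = 'X_[(\sum_i U_(mxvec_index i (a i)))%MM].
  by rewrite mprodXE.
have sum_at (a : 'I_m -> 'I_n) i j :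
    (\sum_i U_(mxvec_index i (a i)))%MM (mxvec_index i j) = (a i == j) :> nat.
  rewrite mnm_sumE (bigD1 i) //= mnm1E eq_mxvec_index eqxx big1 ?addn0 // => k /negPf ki.
  by rewrite mnm1E eq_mxvec_index ki.
apply: mono_ideal_genE; first exact: gin_mon_up.
  move=> _ [a rado_a <-]; rewrite prodE; apply/mono_idealX; exists a; split=> // i.
  by rewrite sum_at eqxx.
move=> t [a [rado_a ta]]; apply: (ideal_genXM (u := (\sum_i U_(mxvec_index i (a i)))%MM)).
  by exists a; rewrite ?prodE.
apply/mnm_lepP => k; case/mxvec_indexP: k => i j; rewrite sum_at.
by case: eqP => // <-; apply: ta.
Qed.

Definition var_mons (a : 'I_m -> nat) (t : 'X_{1..(m * n)}) :=
  exists i (j : 'I_n), (j < a i)%N /\ (0 < t (mxvec_index i j))%N.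

Lemma PidealE a : Pideal K n a = mono_ideal (var_mons a).
Proof.
apply: mono_ideal_genE.
- by move=> t u [i [j [lt_ja tij]]]; exists i, j; rewrite mnmDE addn_gt0 tij orbT.
- move=> _ [i [j [lt_ja ->]]]; apply/mono_idealX; exists i, j.
  by rewrite mnm1E eqxx.
- move=> t [i [j [lt_ja tij]]]; apply: (ideal_genXM (u := U_(mxvec_index i j)%MM)).
    by exists i, j.
  by rewrite lep1mP -lt0n.
Qed.

(** A generator outside [P_a] would have all indices above [a] and so break the
    inequality of the set attached to [a]. Conversely a monomial that is not a
    multiple of a generator yields, through [not_gin_mon], an element of the index
    set whose prime misses it. *)
Lemma gin_mon_cap (b : {set 'I_m} -> nat) :
  (forall A B : {set 'I_m}, A \subset B -> b A <= b B)%N -> (forall A, b A <= n)%N ->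
  mono_ideal (gin_mon b) = (\bigcap_(a in Cset b) Pideal K n a)%classic.
Proof.
move=> mono_b b_le; apply/seteqP; split=> f.
  move=> Jf a [A [a0 sum_a]]; rewrite PidealE => t /Jf [c [rado_c tc]].
  apply: contrapT => nPt.
  have le_ac i : (a i <= c i)%N.
    by rewrite leqNgt; apply/negP => lt_ca; apply: nPt; exists i, (c i).
  have := rado_c A; have : (\sum_(i in A) (a i).+1 <= \sum_(i in A) (c i).+1)%N.
    by apply: leq_sum => i _; rewrite ltnS.
  have -> : (\sum_(i in A) (a i).+1 = \sum_(i in A) a i + #|A|)%N.
    by rewrite -sum1_card -big_split /=; apply: eq_bigr => i _; rewrite addn1.
  by move: sum_a; lia.
move=> capf t tf; apply: contrapT => /(not_gin_mon mono_b b_le).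
case=> [A [a [t0 a0 sum_a _]]].
have : Cset b a.
  exists A; split=> //; move: sum_a.
  have -> : (\sum_(i in A) (a i).+1 = \sum_(i in A) a i + #|A|)%N.
    by rewrite -sum1_card -big_split /=; apply: eq_bigr => i _; rewrite addn1.
  by lia.
move/capf; rewrite PidealE => /(_ t tf) [i [j [lt_ja]]].
by rewrite t0.
Qed.

(** [P_a] is the kernel of the endomorphism killing its variables, and the target is
    a domain. *)
Lemma Pideal_radical (a : 'I_m -> nat) : is_radical (Pideal K n a).
Proof.
pose F : 'M[S]_(m, n) := \matrix_(i, j) if (j < a i)%N then 0 else xvar K i j.
have FX t : subst_mx F 'X_[t] = if asbool (var_mons a t) then 0 else 'X_[t].
  rewrite subst_mpolyX; case: asboolP => [[i [j [lt_ja tij]]]|nPt].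
    by rewrite (bigD1 i) //= (bigD1 j) //= mxE lt_ja expr0n gtn_eqF // !mul0r.
  rewrite mpolyXE_id big_mxvec; apply: eq_bigr => i _; apply: eq_bigr => j _.
  rewrite mxE; case: ifP => // lt_ja; case: (posnP (t (mxvec_index i j))) => [->//|tij].
  by case: nPt; exists i, j.
have kerF f : Pideal K n a f <-> subst_mx F f = 0.
  rewrite PidealE subst_mpolyE; split=> [Pf|sum0 t tf].
    rewrite big_seq big1 // => t /Pf Pt; rewrite FX; case: asboolP => // _.
    exact: scaler0.
  apply: contrapT => nPt; move: tf; rewrite mcoeff_msupp => /eqP; apply.
  have [tf|/memN_msupp_eq0 //] := boolP (t \in msupp f).
  move/(congr1 (mcoeff t)): sum0; rewrite mcoeff0 raddf_sum (bigD1_seq t) ?msupp_uniq //=.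
  rewrite FX; case: asboolP => // _; rewrite mcoeffZ mcoeffX eqxx mulr1.
  rewrite big1 ?addr0 // => u /negPf ut; rewrite FX mcoeffZ.
  by case: ifP => _; rewrite ?mcoeff0 ?mcoeffX ?ut mulr0.
move=> f k /kerF; rewrite rmorphXn => /eqP; rewrite expf_eq0 => /andP[_ /eqP ?].
exact/kerF.
Qed.

End MonomialIdeals.

(** * The group action *)

Section Action.
Variables (K : fieldType) (m n : nat).
Local Notation S := {mpoly K[m * n]}.
Implicit Types (g h : 'I_m -> 'M[K]_n) (f : S).

Definition act_mx g : 'M[S]_(m, n) := \matrix_(i, j) \sum_k g i k j *: xvar K i k.

Lemma actE g f : act g f = subst_mx (act_mx g) f.
Proof. by []. Qed.

Lemma subst_comp (F G : 'M[S]_(m, n)) f :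
  subst_mx F (subst_mx G f) = subst_mx (map_mx (subst_mx F) G) f.
Proof.
rewrite [subst_mx G f]subst_mpolyE [RHS]subst_mpolyE linear_sum.
apply: eq_bigr => t _; rewrite linearZ /= !subst_mpolyX rmorph_prod; congr (_ *: _).
apply: eq_bigr => i _; rewrite rmorph_prod; apply: eq_bigr => j _.
by rewrite rmorphXn mxE.
Qed.

Lemma subst_id f : subst_mx (\matrix_(i, j) xvar K i j) f = f.
Proof.
rewrite -[RHS]comp_mpoly_id /subst_mx; congr comp_mpoly.
apply: eq_mktuple => k; case/mxvec_indexP: k => i j.
by rewrite mxvecE mxE.
Qed.

Lemma act_comp g h f : act h (act g f) = act (fun i => h i *m g i) f.
Proof.
rewrite !actE subst_comp; congr (subst_mx _ f).
apply/matrixP => i j; rewrite !mxE linear_sum /=.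
under eq_bigr do rewrite linearZ /= subst_xvar mxE scaler_sumr.
rewrite exchange_big; apply: eq_bigr => l _ /=; rewrite mxE scaler_suml.
by apply: eq_bigr => k _; rewrite scalerA mulrC.
Qed.

Lemma act1 f : act (fun=> 1%:M) f = f.
Proof.
rewrite actE -[RHS]subst_id; congr (subst_mx _ f); apply/matrixP => i j; rewrite !mxE.
rewrite (bigD1 j) //= mxE eqxx scale1r big1 ?addr0 // => k /negPf kj.
by rewrite mxE kj scale0r.
Qed.

Lemma actK g f : GLm g -> act (fun i => invmx (g i)) (act g f) = f.
Proof.
move=> Gg; rewrite act_comp -[RHS]act1; congr (act _ f).
by apply/funext => i; rewrite mulVmx.
Qed.

Lemma actVK g f : GLm g -> act g (act (fun i => invmx (g i)) f) = f.
Proof.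
move=> Gg; rewrite act_comp -[RHS]act1; congr (act _ f).
by apply/funext => i; rewrite mulmxV.
Qed.

Lemma act_graded g a f : graded_piece a f -> graded_piece a (act g f).
Proof.
move=> fa; rewrite actE subst_mpolyE big_seq; apply: graded_piece_sum => t /fa ta.
apply: graded_pieceZ; rewrite subst_mpolyX -ta.
have -> : mono_deg t = \sum_i \sum_(j < n) delta_mx 0 i *+ t (mxvec_index i j).
  apply/rowP => i; rewrite mxE summxE [RHS](bigD1 i) //=.
  rewrite [X in _ = _ + X]big1 ?addr0 => [|k ki]; last first.
    rewrite summxE big1 // => j _; rewrite mulmxnE mxE [i == k]eq_sym (negPf ki) andbF.
    by rewrite mul0rn.
  rewrite summxE (big_morph _ PoszD (erefl : Posz 0 = 0)); apply: eq_bigr => j _.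
  by rewrite mulmxnE mxE !eqxx -mulrnA mul1n natz.
apply: graded_piece_prod => i _; apply: graded_piece_prod => j _.
apply: graded_pieceXn.
rewrite mxE; apply: graded_piece_sum => k _; apply: graded_pieceZ.
rewrite -(mono_deg_var i k); exact: graded_pieceX.
Qed.

Lemma ideal_preim (R R' : comNzRingType) (phi : {rmorphism R -> R'}) (I : set R') :
  is_ideal I -> is_ideal (phi @^-1` I)%classic.
Proof.
move=> [I0 ID IM]; split=> [|p q Ip Iq|p q Iq] /=; rewrite /preimage /=.
- by rewrite rmorph0.
- by rewrite rmorphD; apply: ID.
- by rewrite rmorphM; apply: IM.
Qed.

Lemma act_minors g (w : 'I_m -> 'I_n -> 'rV[K]_n) (L : 'M[S]_(m, n)) :
  GLm g -> map_mx (act g) L = forms_mx w ->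
  (act g @` max_minors_ideal L)%classic = max_minors_ideal (forms_mx w).
Proof.
move=> Gg Lw; have act_minor (h : 'I_m -> 'I_n) :
    act g (\det (colsub h L)) = \det (colsub h (forms_mx w)).
  rewrite actE -det_map_mx; congr (\det _).
  by rewrite -Lw; apply/matrixP => i j; rewrite !mxE.
apply/seteqP; split=> [_ [f If <-]|f If].
  suff: (subst_mx (act_mx g) @^-1` max_minors_ideal (forms_mx w))%classic f by [].
  apply: (ideal_gen_min _ _ If); first by apply: ideal_preim; apply: ideal_gen_ideal.
  move=> _ [h hh <-]; rewrite /preimage /= -actE act_minor.
  by apply: sub_ideal_gen; exists h.
exists (act (fun i => invmx (g i)) f); last exact: actVK.
suff: (subst_mx (act_mx (fun i => invmx (g i))) @^-1` max_minors_ideal L)%classic f by [].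
apply: (ideal_gen_min _ _ If); first by apply: ideal_preim; apply: ideal_gen_ideal.
move=> _ [h hh <-]; rewrite /preimage /= -actE -act_minor actK //.
by apply: sub_ideal_gen; exists h.
Qed.

(** Back substitution along a row of the inverse, the diagonal entries being
    nonzero. *)
Lemma borel_inv g : borel g -> borel (fun i => invmx (g i)).
Proof.
case=> Gg tri; split=> [i|i k j]; first by rewrite unitmx_inv.
have diag l : g i l l != 0.
  have trig : is_trig_mx (g i)^T.
    by apply/is_trig_mxP => x y xy; rewrite mxE tri.
  have := Gg i; rewrite unitmxE -det_tr det_trig // unitfE => /prodf_neq0 /(_ l isT).
  by rewrite mxE.
have [N] := ubnP (val j); elim: N j => // N IHN j ltN lt_jk.
have kj : (k == j) = false by exact: gtn_eqF lt_jk.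
have /matrixP/(_ k j) := mulVmx (Gg i); rewrite !mxE kj.
rewrite (bigD1 j) //= big1 ?addr0 => [/eqP|l lj].
  by rewrite mulf_eq0 (negPf (diag j)) orbF => /eqP.
have [lt_lj|lt_jl|/val_inj eq_lj] := ltngtP l j; last by rewrite eq_lj eqxx in lj.
  by rewrite IHN ?mul0r //; [exact: leq_trans lt_lj ltN|exact: ltn_trans lt_lj lt_jk].
by rewrite tri ?mulr0.
Qed.

Lemma borel_Pideal g (a : 'I_m -> nat) f :
  borel g -> Pideal K n a f -> Pideal K n a (act g f).
Proof.
move=> [_ tri] Pf.
suff: (subst_mx (act_mx g) @^-1` Pideal K n a)%classic f by [].
apply: (ideal_gen_min _ _ Pf); first by apply: ideal_preim; apply: ideal_gen_ideal.
move=> _ [i [j [lt_ja ->]]]; rewrite /preimage /= subst_xvar mxE.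
apply: ideal_sum => [|k _]; first exact: ideal_gen_ideal.
have [lt_jk|le_kj] := ltnP j k; first last.
  rewrite -mul_mpolyC; apply: (@ideal_mul _ (Pideal K n a)); first exact: ideal_gen_ideal.
  by apply: sub_ideal_gen; exists i, k; split=> //; apply: leq_ltn_trans lt_ja.
rewrite tri // scale0r; apply: (@ideal_zero _ (Pideal K n a)); exact: ideal_gen_ideal.
Qed.

Lemma borel_cap (C : set ('I_m -> nat)) :
  borel_fixed (\bigcap_(a in C) Pideal K n a)%classic.
Proof.
have stable g f : borel g -> (\bigcap_(a in C) Pideal K n a)%classic f ->
    (\bigcap_(a in C) Pideal K n a)%classic (act g f).
  by move=> Bg Jf a Ca; apply: borel_Pideal => //; apply: Jf.
move=> g Bg; apply/seteqP; split=> [_ [f Jf <-]|f Jf]; first exact: stable.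
exists (act (fun i => invmx (g i)) f); last by apply: actVK; case: Bg.
by apply: stable => //; apply: borel_inv.
Qed.

End Action.

(** * Existence of a term order *)

Section TermOrderExists.
Variables m n : nat.

Lemma index_allpairs_pair (T1 T2 : eqType) (s : seq T1) (t : seq T2) x y :
  x \in s -> y \in t ->
  index (x, y) [seq (x', y') | x' <- s, y' <- t] = (index x s * size t + index y t)%N.
Proof.
move=> xs yt; elim: s xs => //= x' s IHs; rewrite inE eq_sym index_cat size_map.
have [<-|x'x /=] := eqVneq x' x.
  by move=> _; rewrite map_f // index_map // => ? ? [].
move=> xs; rewrite IHs // mulSn addnA; case: ifP => // /mapP[? _ [xx']].
by rewrite xx' eqxx in x'x.
Qed.

Lemma mxvec_index_lt (i : 'I_m) (j k : 'I_n) :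
  (j < k)%N -> (mxvec_index i j < mxvec_index i k)%N.
Proof.
have rankE (T : finType) (x : T) : enum_rank x = index x (enum T) :> nat.
  rewrite -{2}(nth_enum_rank x x) index_uniq ?enum_uniq // -cardE.
  exact: ltn_ord.
move=> lt_jk; rewrite /= !rankE enumT unlock /= /prod_enum.
by rewrite !index_allpairs_pair ?mem_enum // ltn_add2l !index_enum_ord.
Qed.

(** The degree lexicographic order; only its comparison of the variables inside a
    block depends on how pairs of indices are enumerated. *)
Lemma term_order_exists : exists tau : rel 'X_{1..(m * n)}, term_order tau.
Proof.
exists (fun t u => (t <= u)%O); split=> //.
- split; [exact: le_total|exact: le_anti|exact: le_trans].
- exact: le0m.
- by move=> t u v le_tu; rewrite lemc_add2l.
- move=> i j k lt_jk; apply/ltW/ltmcP; first by rewrite !mdeg1.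
  have lt_idx := mxvec_index_lt i lt_jk.
  exists (mxvec_index i j) => [l lt_l|]; rewrite !mnm1E.
    have -> : (mxvec_index i j == l) = false by exact: gtn_eqF lt_l.
    by have -> : (mxvec_index i k == l) = false by exact: gtn_eqF (ltn_trans lt_l lt_idx).
  by rewrite eqxx; have -> : (mxvec_index i k == mxvec_index i j) = false by exact: gtn_eqF.
Qed.

Lemma term_order_monomial (tau : rel 'X_{1..(m * n)}) :
  term_order tau -> monomial_order tau.
Proof. by case=> -[? ? ?] _ ? _; split. Qed.

End TermOrderExists.

(** * The coefficient matrices of L *)

Section Coefficients.
Variables (K : fieldType) (m n : nat).
Local Notation S := {mpoly K[m * n]}.

Lemma row_graded_forms (L : 'M[S]_(m, n)) : row_graded L ->
  exists M : 'I_m -> 'M[K]_n, L = forms_mx (fun i k => row k (M i)).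
Proof.
move=> grL.
have /choice [lam lamE] : forall p : 'I_m * 'I_n, exists l : 'I_n -> K,
    L p.1 p.2 = \sum_k l k *: xvar K p.1 k by move=> p; apply: grL.
exists (fun i => \matrix_(k, c) lam (i, c) k); apply/matrixP => i c.
by rewrite mxE (lamE (i, c)); apply: eq_bigr => k _; rewrite !mxE.
Qed.

Variable M : 'I_m -> 'M[K]_n.
Let L : 'M[S]_(m, n) := forms_mx (fun i k => row k (M i)).

Lemma act_forms g : map_mx (act g) L = forms_mx (moved_rows M g).
Proof.
apply/matrixP => i c; rewrite mxE actE subst_forms_mx [RHS]mxE.
under eq_bigr do rewrite !mxE scaler_sumr.
rewrite exchange_big; apply: eq_bigr => l _ /=; rewrite !mxE scaler_suml.
by apply: eq_bigr => k _; rewrite scalerA mulrC.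
Qed.

Lemma moved_rows_sub g i j : (moved_rows M g i j <= M i)%MS.
Proof. by rewrite /moved_rows row_mul submxMl. Qed.

Lemma xvar_indep (c : 'I_n -> K) i :
  \sum_k c k *: xvar K i k = 0 :> S -> forall k, c k = 0.
Proof.
move=> sum0 k; move/(congr1 (mcoeff U_(mxvec_index i k)%MM)): sum0.
rewrite mcoeff0 raddf_sum (bigD1 k) //= mcoeffZ mcoeffX eqxx mulr1.
rewrite big1 ?addr0 // => l /negPf lk.
by rewrite mcoeffZ mcoeffX eq_mnm1 eq_mxvec_index lk andbF mulr0.
Qed.

(** Column rank equals row rank: a combination of the subcolumns vanishes exactly
    when its vector of coefficients is orthogonal to the row spaces of all [M i]
    with [i] in [A]. *)
Lemma bLE A : bL L A = sum_rank M A.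
Proof.
rewrite /sum_rank -mxrank_tr; apply/subdimE/has_dim_rank => v.
set N := (\sum_(i in A) M i)%MS.
have subE (i : {i : 'I_m | i \in A}) : (\sum_c v 0 c *: subcolumn L A c) i =
    \sum_k (M (val i) *m v^T) k 0 *: xvar K (val i) k.
  rewrite sum_ffunE; under eq_bigr do rewrite !ffunE mxE scaler_sumr.
  rewrite exchange_big; apply: eq_bigr => k _ /=; rewrite mxE scaler_suml.
  by apply: eq_bigr => c _; rewrite !mxE scalerA mulrC.
have kerE : v *m N^T = 0 <-> (N <= kermx v^T)%MS.
  split=> [vN|/sub_kermxP vN]; last by rewrite -[LHS]trmxK trmx_mul trmxK vN trmx0.
  by apply/sub_kermxP; rewrite -[LHS]trmxK trmx_mul trmxK vN trmx0.
rewrite kerE; split=> [sum0|subker].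
  apply/sumsmx_subP => i iA; apply/sub_kermxP/matrixP => k l; rewrite ord1 [RHS]mxE.
  apply: (@xvar_indep (fun k => (M i *m v^T) k 0) i).
  by rewrite -(subE (exist _ i iA)) sum0 ffunE.
apply/ffunP => i; rewrite subE ffunE big1 // => k _.
have /sub_kermxP -> : (M (val i) <= kermx v^T)%MS.
  by apply: submx_trans subker; apply: (sumsmx_sup (val i)) => //; apply: valP.
by rewrite mxE scale0r.
Qed.

End Coefficients.

(** * The theorem *)

Unset Implicit Arguments.
Local Open Scope classical_set_scope.
Local Open Scope ring_scope.

Theorem theorem2p2 (K : fieldType) (m n : nat)
    (L : 'M[{mpoly K[m * n]}]_(m, n)) :
  infinite_set [set: K] -> (1 <= m)%N -> (m <= n)%N -> row_graded L ->
  [/\ cartwright_sturmfels (max_minors_ideal L),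
      is_gin (max_minors_ideal L) (ideal_gen (gin_generators K n (bL L))) &
      is_gin (max_minors_ideal L)
        (\bigcap_(a in Cset (bL L)) Pideal K n a)].
Proof.
move=> infK _ _ /row_graded_forms [M ->]; set I := max_minors_ideal _.
have -> : bL (forms_mx (fun i k => row k (M i))) = sum_rank M.
  by apply/funext => A; apply: bLE.
pose J : set {mpoly K[m * n]} := mono_ideal (gin_mon (sum_rank M)).
have capE : J =
    (\bigcap_(a in Cset (sum_rank M)) Pideal K n a)%classic.
  apply: gin_mon_cap => [A B AB|A]; last exact: rank_leq_col.
  apply/mxrankS/sumsmx_subP => i iA.
  by apply: (sumsmx_sup i) => //; apply: (fintype.subsetP AB).
have [U [openU U0 genU]] := generic_dual_family M infK.
have moved g : U g -> (act g @` I)%classic = max_minors_ideal (forms_mx (moved_rows M g)).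
  by case/genU => Gg _; apply: act_minors => //; apply: act_forms.
have lead_in tau g t : U g -> term_order tau -> gin_mon (sum_rank M) t ->
    exists2 f, (act g @` I)%classic f & is_lead_mon tau f t.
  move=> Ug tau_order; rewrite moved //; have [_ _ _ tau_var] := tau_order.
  apply: gin_mon_is_lead => //; last exact: term_order_monomial.
  by case: (genU g Ug).
have lead_out tau g f t : U g -> term_order tau -> (act g @` I)%classic f ->
    is_lead_mon tau f t -> gin_mon (sum_rank M) t.
  move=> Ug tau_order; rewrite moved //; have [_ _ _ tau_var] := tau_order.
  apply: lead_is_gin_mon => //; [exact: moved_rows_sub|by case: (genU g Ug)|].
  exact: term_order_monomial.
have ginP : is_gin I J.
  move=> tau tau_order; exists U; split=> // g Ug; apply: initial_idealE.
  - exact: term_order_monomial.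
  - by rewrite moved //; apply: ideal_gen_ideal.
  - by move=> t; apply: lead_in.
  - by move=> f t; apply: lead_out.
split; [|by rewrite gin_generatorsE|by rewrite -capE].
have grI : is_graded I by apply: max_minors_graded.
split=> //; first exact: ideal_gen_ideal.
exists J; split.
- by apply: mono_ideal_ideal; apply: gin_mon_up.
- by rewrite capE => f k Jf a Ca; apply: (@Pideal_radical _ _ _ _ f k); apply: Jf.
- by rewrite capE; apply: borel_cap.
- exact: mono_ideal_graded.
move=> a; have [tau tau_order] := term_order_exists m n.
have tau_mono := term_order_monomial tau_order.
have [g Ug] := U0; have Gg : GLm g by case: (genU g Ug).
pose d := size (deg_mons (@gin_mon m n (sum_rank M)) a).
have dimJ : has_dim (J `&` graded_piece a)%classic d.
  rewrite /d.
  apply: (has_dim_graded tau_mono).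
  - by apply: mono_ideal_ideal; apply: gin_mon_up.
  - exact: mono_ideal_graded.
  - by move=> t; apply: mono_ideal_lead.
  - by move=> f t Jf [tf _]; apply: Jf.
have dim_gI : has_dim ((act g @` I) `&` graded_piece a)%classic d.
  rewrite /d.
  apply: (has_dim_graded tau_mono).
  - by rewrite moved //; apply: ideal_gen_ideal.
  - by rewrite moved //; apply: max_minors_graded.
  - by move=> t; apply: lead_in.
  - by move=> f t; apply: lead_out.
rewrite /hilbert (subdimE dimJ); apply/esym/subdimE.
have -> : (I `&` graded_piece a)%classic =
    (subst_mx (act_mx (fun i => invmx (g i))) @` ((act g @` I) `&` graded_piece a))%classic.
  apply/seteqP; split=> [f [If fa]|_ [_ [[f If <-] fa] <-]].
    exists (act g f); last by rewrite -actE actK.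
    by split; [exists f|apply: act_graded].
  rewrite -actE; split; first by rewrite actK.
  by apply: act_graded.
apply: has_dim_image dim_gI => f f' eq_f.
by rewrite -(actVK f Gg) -[RHS](actVK f' Gg); congr (act g _).
Qed.
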